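(* Fix an integer $n\ge4$ and let $P_t=e^{-tA_{\psi_n}}$ for $t\ge 0$. For all $1<p\le q<\infty$ and $t\ge0$, the inequality $$\|P_tf\|_q\le\|f\|_p\qquad\text{for all } f:\mathbb Z_n\to\mathbb C$$ holds if and only if $$t\ge\frac12\log\frac{q-1}{p-1}.$$
   Context: $\mathbb Z_n=\mathbb Z/n\mathbb Z$ with the uniform probability measure $\pi$; $\|f\|_p=\left(\frac1n\sum_{x\in\mathbb Z_n}|f(x)|^p\right)^{1/p}$. Fourier coefficients: $\widehat f(k)=\frac1n\sum_{x\in\mathbb Z_n}f(x)e^{-2\pi i kx/n}$. The word length is $\psi_n(k)=\min(k,n-k)$ for $k\in\{0,\dots,n-1\}$. The word-length Laplacian is $A_{\psi_n}f(x)=\sum_{k=0}^{n-1}\psi_n(k)\widehat f(k)e^{2\pi i kx/n}$; thus $P_tf(x)=\sum_{k=0}^{n-1}e^{-t\psi_n(k)}\widehat f(k)e^{2\pi i kx/n}$. *)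

(* Defs.v *)
From HB Require Import structures.
From mathcomp Require Import all_boot all_order all_algebra.
From mathcomp Require Import all_classical all_reals all_analysis.
From mathcomp Require Import complex.
From mathcomp Require Import ring lra.

Set Implicit Arguments.
Unset Strict Implicit.
Unset Printing Implicit Defensive.

Import Order.TTheory GRing.Theory Num.Theory.
Import numFieldNormedType.Exports.
Import Normc.

Local Open Scope classical_set_scope.
Local Open Scope ring_scope.
Local Open Scope complex_scope.

Definition expi (R : realType) (a : R) : R[i] := cos a +i* sin a.

(* Functions are indexed by 'Z_n, which is Z/nZ as soon as 1 < n; frequencies
   are their representatives k in {0, ..., n-1}, as natural numbers. *)
Section WordLengthSemigroup.
Variables (R : realType) (n : nat).
Implicit Types (f : 'Z_n -> R[i]) (x : 'Z_n) (k : nat).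

Definition angle k (x : nat) : R := 2 * pi * k%:R * x%:R / n%:R.

Definition fourier_coef f k : R[i] :=
  (n%:R)^-1 * \sum_(x : 'Z_n) f x * expi (- angle k x).

Definition fourier_multiplier (m : nat -> R) f : 'Z_n -> R[i] := fun x =>
  \sum_(k < n) (m k)%:C * fourier_coef f k * expi (angle k x).

Definition word_length k : nat := minn k (n - k).

Definition laplacian : ('Z_n -> R[i]) -> 'Z_n -> R[i] :=
  fourier_multiplier (fun k => (word_length k)%:R).

(* exp (- t * laplacian), in spectral form: see laplacian_exp below. *)
Definition semigroup (t : R) : ('Z_n -> R[i]) -> 'Z_n -> R[i] :=
  fourier_multiplier (fun k => expR (- t * (word_length k)%:R)).

(* normc : R[i] -> R is the modulus. *)
Definition pnorm (p : R) f : R :=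
  ((n%:R)^-1 * \sum_(x : 'Z_n) normc (f x) `^ p) `^ p^-1.

End WordLengthSemigroup.

Section Exponential.
Variables (R : realType) (n : nat).
Hypothesis n_gt1 : (1 < n)%N.
Implicit Types (f : 'Z_n -> R[i]).

Let n_neq0 : n%:R != 0 :> R. Proof. by rewrite pnatr_eq0 -lt0n ltnW. Qed.
Let nC_neq0 : n%:R != 0 :> R[i]. Proof. by rewrite pnatr_eq0 -lt0n ltnW. Qed.

Lemma expiD (a b : R) : expi (a + b) = expi a * expi b.
Proof. by rewrite /expi cosD sinD; simpc; rewrite (addrC (sin a * _)). Qed.

Lemma expi0 : expi (0 : R) = 1.
Proof. by rewrite /expi cos0 sin0. Qed.

Lemma expiMn (a : R) (m : nat) : expi (a * m%:R) = expi a ^+ m.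
Proof.
elim: m => [|m IHm]; first by rewrite mulr0 expi0 expr0.
by rewrite mulrS mulrDr mulr1 expiD IHm exprS.
Qed.

Lemma expi_2pi (j : nat) : expi (2 * pi * j%:R : R) = 1.
Proof. by rewrite expiMn mulr_natl /expi cos2pi sin2pi expr1n. Qed.

Lemma angleC (k x : nat) : angle R n k x = angle R n x k.
Proof. by rewrite /angle; congr (_ / _); ring. Qed.

Lemma expi_angle_neq1 (j k : nat) : (k < j < n)%N ->
  expi (angle R n j 1 - angle R n k 1) != 1.
Proof.
move=> /andP[kj jn]; pose a : R := pi * (j - k)%:R / n%:R.
have -> : angle R n j 1 - angle R n k 1 = a *+ 2.
  by rewrite /angle /a natrB ?(ltnW kj)// mulr2n; field.
apply/negP; rewrite eq_complex /= => /andP[/eqP h _].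
have n0 : 0 < n%:R :> R by rewrite ltr0n ltnW.
have a0 : 0 < a by rewrite divr_gt0// mulr_gt0 ?pi_gt0// ltr0n subn_gt0.
have api : a < pi.
  rewrite ltr_pdivrMr// ltr_pM2l ?pi_gt0// ltr_nat.
  by rewrite (leq_ltn_trans _ jn)// leq_subr.
have : 0 < sin a by apply: sin_gt0_pi; rewrite a0.
move: h; rewrite mulr2n cosD -!expr2 cos2sin2 => h hs.
have : 0 < sin a ^+ 2 by rewrite exprn_gt0.
lra.
Qed.

Lemma expi_orthogonal (j k : nat) : (j < n)%N -> (k < n)%N ->
  \sum_(m < n) expi (angle R n j m) * expi (- angle R n k m) =
  (n * (j == k))%:R.
Proof.
move=> jn kn; pose w := expi (angle R n j 1 - angle R n k 1).
have wE m : expi (angle R n j m) * expi (- angle R n k m) = w ^+ m.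
  by rewrite -expiD /w -expiMn; congr expi; rewrite /angle; field.
rewrite (eq_bigr (fun m : 'I_n => w ^+ m)); last by move=> m _; exact: wE.
have [jk|jk] := eqVneq j k.
  rewrite muln1 (eq_bigr (fun=> 1)); last first.
    by move=> m _; rewrite /w jk subrr expi0 expr1n.
  by rewrite sumr_const card_ord.
rewrite muln0; have w1 : w != 1.
  have [kj|jk'|/eqP] := ltngtP k j; last by rewrite eq_sym (negPf jk).
    by apply: expi_angle_neq1; rewrite kj.
  have : expi (angle R n k 1 - angle R n j 1) != 1.
    by apply: expi_angle_neq1; rewrite jk'.
  apply: contraNneq => w1.
  have : expi (angle R n k 1 - angle R n j 1) * w = 1.
    by rewrite -expiD addrA subrK subrr expi0.
  by rewrite w1 mulr1 => ->.
have wn : w ^+ n = 1.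
  rewrite -wE -expiD.
  have -> : angle R n j n - angle R n k n = 2 * pi * j%:R - 2 * pi * k%:R.
    by rewrite /angle; field.
  by have := expi_2pi j; rewrite -{1}(subrK (2 * pi * k%:R) (_ * j%:R))
     expiD expi_2pi mulr1.
have : (w - 1) * \sum_(m < n) w ^+ m = 0 by rewrite -subrX1 wn subrr.
by move=> /eqP; rewrite mulf_eq0 subr_eq0 (negPf w1) => /eqP.
Qed.

Let sumZ (F : nat -> R[i]) : \sum_(x : 'Z_n) F x = \sum_(m < n) F m.
Proof. by rewrite -(big_mkord xpredT F) Zp_cast// big_mkord. Qed.

Lemma fourier_inversion f : fourier_multiplier (fun=> 1) f = f.
Proof.
have ltZ (z : 'Z_n) : (z < n)%N.
  by have := ltn_ord z; rewrite [X in (_ < X)%N]Zp_cast.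
apply/funext => x; rewrite /fourier_multiplier /fourier_coef.
rewrite (eq_bigr (fun k : 'I_n => (n%:R)^-1 * \sum_(y : 'Z_n)
    f y * (expi (angle R n x k) * expi (- angle R n y k)))); last first.
  move=> k _; rewrite mul1r -mulrA mulr_suml; congr (_ * _).
  apply: eq_bigr => y _.
  by rewrite (angleC k x) (angleC k y) -mulrA [X in _ * X]mulrC.
rewrite -mulr_sumr exchange_big /=.
under eq_bigr => y _ do rewrite -mulr_sumr expi_orthogonal//.
rewrite (bigD1 x)//= [X in _ + X]big1 ?addr0; last first.
  move=> y yx; rewrite [_ == _ :> nat](_ : _ = false) ?muln0 ?mulr0//.
  by rewrite eq_sym; exact/negbTE.
by rewrite eqxx muln1 mulrCA mulVf ?mulr1.
Qed.

Lemma fourier_coef_multiplier (m : nat -> R) f (k : nat) : (k < n)%N ->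
  fourier_coef (fourier_multiplier m f) k = (m k)%:C * fourier_coef f k.
Proof.
move=> kn; rewrite {1}/fourier_coef /fourier_multiplier.
under eq_bigr => x _ do rewrite mulr_suml.
rewrite exchange_big /= (bigD1 (Ordinal kn))//= [X in _ + X]big1 ?addr0.
  under eq_bigr => x _ do rewrite -mulrA.
  rewrite -mulr_sumr (sumZ (fun x => expi (angle R n k x)
    * expi (- angle R n k x))).
  by rewrite expi_orthogonal// eqxx muln1 mulrCA mulVf ?mulr1.
move=> j jk; under eq_bigr => x _ do rewrite -mulrA.
rewrite -mulr_sumr (sumZ (fun x => expi (angle R n j x)
  * expi (- angle R n k x))).
rewrite expi_orthogonal// [_ == _ :> nat](_ : _ = false) ?muln0 ?mulr0//.
exact/negbTE.
Qed.

Lemma iter_laplacian (m : nat) f : iter m (@laplacian R n) f =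
  fourier_multiplier (fun k => (word_length n k)%:R ^+ m) f.
Proof.
elim: m => [|m IHm] /=; first by rewrite fourier_inversion.
rewrite IHm; apply/funext => x; apply: eq_bigr => k _.
by rewrite fourier_coef_multiplier// mulrA -rmorphM/= exprS.
Qed.

Lemma laplacian_exp (t : R) f (x : 'Z_n)
    (S := fun N : nat =>
       \sum_(m < N) ((- t) ^+ m / m`!%:R)%:C * iter m (@laplacian R n) f x) :
  (fun N => complex.Re (S N)) @ \oo --> complex.Re (semigroup t f x) /\
  (fun N => complex.Im (S N)) @ \oo --> complex.Im (semigroup t f x).
Proof.
pose e N k : R := series (exp_coeff (- t * (word_length n k)%:R)) N.
pose u k := fourier_coef f k * expi (angle R n k x).
have SE N : S N = \sum_(k < n) (e N k)%:C * u k.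
  rewrite /S; under eq_bigr => m _ do rewrite iter_laplacian mulr_sumr.
  rewrite exchange_big; apply: eq_bigr => k _ /=.
  rewrite /e /series/= big_mkord rmorph_sum/= mulr_suml.
  apply: eq_bigr => m _; rewrite /u !mulrA -rmorphM/=; do 3 congr (_ * _).
  by rewrite /exp_coeff/= exprMn mulrAC.
have PE : semigroup t f x =
    \sum_(k < n) (expR (- t * (word_length n k)%:R))%:C * u k.
  by apply: eq_bigr => k _; rewrite /u mulrA.
have eE k : (fun N => e N k) @ \oo --> expR (- t * (word_length n k)%:R).
  exact: (is_cvg_series_exp_coeff (- t * (word_length n k)%:R)).
have ReM (r : R) z : complex.Re (r%:C * z) = r * complex.Re z.
  by case: z => a b /=; rewrite mul0r subr0.
have ImM (r : R) z : complex.Im (r%:C * z) = r * complex.Im z.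
  by case: z => a b /=; rewrite mul0r addr0.
have sumE (v : nat -> R) : (fun N => \sum_(k < n) e N k * v k) @ \oo -->
    \sum_(k < n) expR (- t * (word_length n k)%:R) * v k.
  apply: cvg_big => [|k _]; first exact: add_continuous.
  by apply: cvgM; [exact: eE|exact: cvg_cst].
split.
- rewrite (_ : (fun N => _) =
      fun N => \sum_(k < n) e N k * complex.Re (u k)); last first.
    by apply/funext => N; rewrite SE raddf_sum/=; under eq_bigr do rewrite ReM.
  by rewrite PE raddf_sum/=; under eq_bigr do rewrite ReM;
    exact: (sumE (fun k => complex.Re (u k))).
- rewrite (_ : (fun N => _) =
      fun N => \sum_(k < n) e N k * complex.Im (u k)); last first.
    by apply/funext => N; rewrite SE raddf_sum/=; under eq_bigr do rewrite ImM.
  by rewrite PE raddf_sum/=; under eq_bigr do rewrite ImM;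
    exact: (sumE (fun k => complex.Im (u k))).
Qed.

End Exponential.

(* Main.v *)
(* A positive function u on Z_n with unit L^2 norm, mean mu and fluctuation
   h = u - mu satisfies, by Taylor expansion of x^2 log(x^2) at 1 (its fourth
   derivative is negative),
     Ent(u^2) <= (4/3) (1 - mu^3) + (2/3) E[h^3].
   In Fourier space E[h^3] is a sum over triples of nonzero frequencies with sum
   0.  As n >= 4, such a triple is not made of frequencies +-1 only, where
   psi - 1 vanishes, and charging it to an entry of maximal word length gives
     E[h^3] <= 3 sum_k (psi(k) - 1) |h^(k)|^2 + (3/4) E[h^2]^2,
   so that Ent(u^2) <= 2 <u, A u>, up to the polynomial (1 - mu)^3 (1 + 3 mu).
   Concavity of psi away from 0 makes the semigroup positivity preserving, and
   Gross's argument turns the logarithmic Sobolev inequality into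
   hypercontractivity.  Conversely, contractivity tested on
   1 + s cos(2 pi x / n) to second order in s forces (q - 1) exp(-2t) <= p - 1. *)
Require Import Defs.
From mathcomp Require Import all_boot all_order all_algebra.
From mathcomp Require Import all_classical all_reals all_analysis.
From mathcomp Require Import complex.
From mathcomp Require Import zify ring lra.

Set Implicit Arguments.
Unset Strict Implicit.
Unset Printing Implicit Defensive.

Import Order.TTheory GRing.Theory Num.Theory.
Import numFieldNormedType.Exports.
Import Normc.

Local Open Scope complex_scope.
Local Open Scope ring_scope.

(** * Frequency triples *)

Section WordLength.
Variable n' : nat.
Local Notation n := n'.+4.
Definition zlength (i : 'Z_n) : nat := word_length n i.
Local Notation psi := zlength.
Implicit Types i j m : 'Z_n.

Lemma ltZ i : (i < n)%N. Proof. exact: ltn_ord. Qed.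

Lemma val_addZ i j : (i + j : 'Z_n) =
  (if (i + j < n)%N then (i + j)%N else (i + j - n)%N) :> nat.
Proof.
rewrite [LHS](_ : _ = (i + j) %% n)%N//; have := ltZ i; have := ltZ j.
case: ifP => [h _ _|h hj hi]; first by rewrite modn_small.
rewrite -[X in (X %% _)%N](@subnK n) ?modnDr ?modn_small//; first by lia.
by rewrite leqNgt h.
Qed.

Lemma val_oppZ i : (- i : 'Z_n) =
  (if (i == 0 :> nat)%N then 0%N else (n - i)%N) :> nat.
Proof.
rewrite [LHS](_ : _ = (n - i) %% n)%N//; have := ltZ i.
by case: eqP => [->|h] hi; rewrite ?subn0 ?modnn// modn_small; lia.
Qed.

Lemma eqZ0 i : (i == 0) = (i == 0%N :> nat). Proof. by []. Qed.

Lemma zlengthN i : psi (- i) = psi i.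
Proof.
by rewrite /zlength /word_length val_oppZ; have := ltZ i; case: ifP => /=; lia.
Qed.

Lemma zlength_eq0 i : (psi i == 0)%N = (i == 0).
Proof. by rewrite /zlength /word_length eqZ0; have := ltZ i; lia. Qed.

(** Up to sign, [i] and [j] are represented by their word lengths, so one of [i + j], [i - j] has
    length |psi(i) - psi(j)|. As both are nonzero, this is less than the larger of the two
    lengths. *)
Lemma zlength_antipodal i j : i != 0 -> j != 0 ->
  [&& psi i <= psi (i + j)%R, psi j <= psi (i + j)%R,
      psi i <= psi (i - j)%R & psi j <= psi (i - j)%R]%N = false.
Proof.
rewrite !eqZ0 /zlength /word_length !val_addZ val_oppZ => i0 j0.
have := ltZ i; have := ltZ j => hj hi.
by rewrite (negPf j0); do 2 case: ifP; lia.
Qed.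

(* The triple (i, j, - (i + j)) is charged to its last entry.  The strict
   inequality makes the count in card_charged immediate, except for the triple
   (i, i, i), which has to be charged as well. *)
Definition charged i j : bool :=
  [&& i != 0, j != 0, (i + j)%R != 0,
      (psi i < psi (i + j)%R)%N || ((i == j) && (i == - (i + j)%R))
    & (psi j <= psi (i + j)%R)%N].

Lemma zlength_inj i j : psi i = psi j -> i = j \/ i + j = 0.
Proof.
rewrite /zlength /word_length => h.
have [->|ij] := eqVneq i j; [by left|right]; apply/eqP.
rewrite eqZ0 val_addZ; have := ltZ i; have := ltZ j.
have : (i != j :> nat) by [].
by case: ifP; lia.
Qed.

(** Unless the three lengths agree, some entry of maximal length is followed cyclically by a
    strictly shorter one, and the triple is charged to it. If they agree, [zlength_inj] makes the
    entries equal, since two opposite entries would force the third to vanish; this is the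
    exceptional triple. *)
Lemma charged_cyclic i j : i != 0 -> j != 0 -> i + j != 0 ->
  charged i j || charged j (- (i + j)) || charged (- (i + j)) i.
Proof.
move=> i0 j0 ij0; have [k kE] : {k : 'Z_n | k = - (i + j)} by exists (- (i + j)).
rewrite -kE.
have k0 : k != 0 by rewrite kE oppr_eq0.
have ijE : i + j = - k by rewrite kE opprK.
have jkE : j + k = - i by rewrite kE opprD addrA addrAC subrr add0r.
have kiE : k + i = - j by rewrite kE opprD addrAC addNr add0r.
rewrite /charged ijE jkE kiE !zlengthN !opprK !oppr_eq0 i0 j0 k0 /=.
have [/andP[/eqP ij /eqP jk]|neq] :=
  boolP ((psi i == psi j) && (psi j == psi k)); last first.
  move: neq; lia.
have {}ij : i = j by case: (zlength_inj ij) => // /eqP; rewrite (negPf ij0).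
have {}jk : j = k.
  by case: (zlength_inj jk) => // /eqP; rewrite jkE oppr_eq0 (negPf i0).
by rewrite -jk -ij eqxx leqnn orbT.
Qed.

(** If both pairs were charged, [i + j] and [i - j] would both be at least as long as [i] and [j],
    against [zlength_antipodal]. In the exceptional case [i] is as long as [i + j], so the weak
    inequality still holds. *)
Lemma charged_opp i j : (charged i j + charged i (- j)%R <= 1)%N.
Proof.
have [/andP[i0 j0]|] := boolP ((i != 0) && (j != 0)); last first.
  by rewrite /charged oppr_eq0 negb_and !negbK => /orP[]->; rewrite ?andbF.
have := zlength_antipodal i0 j0; rewrite /charged zlengthN i0 oppr_eq0 j0 /=.
have le3 a b : (a == b) && (a == - (a + b)) -> (psi a <= psi (a + b)%R)%N.
  by move=> /andP[_ /eqP h]; rewrite {1}h zlengthN.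
have := le3 i j; have := le3 i (- j).
move: (psi i) (psi j) (psi (i + j)) (psi (i - j)).
move: ((i == j) && _) ((i == - j) && _) (i + j != 0) (i - j != 0).
move=> [] [] [] [] a b c d /= h1 h2;
by try have {}h1 := h1 isT; try have {}h2 := h2 isT; lia.
Qed.

Lemma card_zlength_lt k : (k <= n./2)%N ->
  (#|[set i | (0 < psi i < k)%N]| <= 2 * k.-1)%N.
Proof.
move=> kn; pose s : seq 'Z_n := map inZp (iota 1 k.-1 ++ iota (n - k).+1 k.-1).
have -> : (2 * k.-1)%N = size s by rewrite size_map size_cat !size_iota mul2n addnn.
apply: leq_trans (card_size s); apply/subset_leq_card/fintype.subsetP => i.
rewrite inE => hi; rewrite -(valZpK i); apply: map_f.
rewrite mem_cat !mem_iota; move: hi (ltZ i); rewrite /zlength /word_length /=; lia.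
Qed.

(** Apart from the exceptional triple, a charged [i] is strictly shorter than [m], and each length
    from 1 to psi(m) - 1 occurs at most twice. The exceptional triple occurs only if 3m = 0, and an
    uncharged element of [B] then makes room for it. *)
Lemma card_charged m : m != 0 ->
  (#|[set i | charged i (m - i)%R]| <= 2 * (psi m).-1)%N.
Proof.
move=> m0; set B := [set i | (0 < psi i < psi m)%N].
have cB : (#|B| <= 2 * (psi m).-1)%N.
  by apply: card_zlength_lt; rewrite /zlength /word_length; lia.
have charged_sub i : charged i (m - i) ->
    [&& (i \in B) || (i == - m) && (m + m + m == 0) & (psi (m - i)%R <= psi m)%N].
  rewrite /charged; have -> : i + (m - i) = m by rewrite addrC subrK.
  move=> /and5P[i0 _ _ h ->]; rewrite andbT inE.
  rewrite lt0n zlength_eq0 i0 /=; case/orP: h => [->//|/andP[/eqP ij /eqP im]].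
  apply/orP; right; rewrite im eqxx /=.
  by move: ij; rewrite im opprK => <-; rewrite addNr.
have [m3|m3] := eqVneq (m + m + m) 0; last first.
  apply: leq_trans cB; apply/subset_leq_card/fintype.subsetP => i.
  rewrite inE => /charged_sub.
  by rewrite (negPf m3) andbF orbF => /andP[].
(* Now m is n/3 or 2n/3 and n is at least 6. Subtracting a suitable unit [e] of length 1 moves [m]
   one step further from 0, so [e] is in [B] but not charged. Here n >= 4 enters: for n = 3 the set
   [B] would be empty. *)
have [e [eB em ]] : exists e, e \in B /\ (psi m < psi (m - e)%R)%N.
  have m3' : (3 * m = n \/ 3 * m = 2 * n)%N.
    move: m3 m0 (ltZ m) => /eqP; rewrite !eqZ0 !val_addZ; do 2 case: ifP; lia.
  have v1 : (1 : 'Z_n) = 1%N :> nat by [].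
  have vN1 : (- 1 : 'Z_n) = n.-1 :> nat by rewrite val_oppZ v1.
  case: m3' => m3'; [exists (-1)|exists 1]; rewrite inE /zlength /word_length.
    rewrite opprK vN1 val_addZ v1; split; first lia.
    case: ifP; lia.
  rewrite val_addZ vN1 v1; split; first lia.
  case: ifP; lia.
apply: (@leq_trans #|(- m) |: (B :\ e)|).
  apply/subset_leq_card/fintype.subsetP => i; rewrite !inE => /charged_sub /andP[].
  have [->|ie] := eqVneq i e; first by rewrite leqNgt em.
  rewrite inE.
  by rewrite /= => /orP[->|/andP[->]]; rewrite ?orbT.
rewrite cardsU1; have := cardsD1 e B; rewrite eB add1n => cBe.
by apply: leq_trans cB; rewrite cBe -[X in (_ <= X)%N]add1n leq_add2r leq_b1.
Qed.

(** Only charged triples are kept, at the price of a factor 3. On these the product is split into a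
    square at the charged entry, counted by [card_charged], and a product of two squares, halved by
    [charged_opp]; this gives 3 and 3/4 = 3 * (1/2) * (1/2). *)
Lemma triple_sum_le (R : realFieldType) (x : 'Z_n -> R) :
  (forall i, 0 <= x i) -> x 0 = 0 -> (forall i, x (- i) = x i) ->
  \sum_i \sum_j x i * x j * x (i + j) <=
  3 * (\sum_i ((psi i)%:R - 1) * x i ^+ 2) + 3 / 4 * (\sum_i x i ^+ 2) ^+ 2.
Proof.
move=> x_ge0 x0 xN.
pose W i j := x i * x j * x (i + j); pose F i j := (charged i j)%:R * W i j.
have W_ge0 i j : 0 <= W i j by rewrite !mulr_ge0.
(* [W] is invariant under rotation of the triple, so the three rotated charged sums are equal and
   together cover every triple with nonzero weight. *)
have step1 : \sum_i \sum_j W i j <= 3 * \sum_i \sum_j F i j.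
  have W1 i j : W j (- (i + j)) = W i j.
    by rewrite /W opprD addrCA subrr addr0 -opprD !xN; ring.
  have W2 i j : W (- (i + j)) i = W i j.
    by rewrite /W opprD addrAC addNr add0r -opprD !xN; ring.
  have F1 : \sum_i \sum_j F j (- (i + j)) = \sum_i \sum_j F i j.
    rewrite exchange_big; apply: eq_bigr => j _.
    rewrite [RHS](reindex_inj (h := fun i => - (i + j)))//.
    by move=> a b /oppr_inj /addIr.
  have F2 : \sum_i \sum_j F (- (i + j)) i = \sum_i \sum_j F i j.
    rewrite [RHS]exchange_big; apply: eq_bigr => i _.
    rewrite [RHS](reindex_inj (h := fun j => - (i + j)))//.
    by move=> a b /oppr_inj /addrI.
  have -> : 3 * \sum_i \sum_j F i j =
     \sum_i \sum_j (F i j + F j (- (i + j)) + F (- (i + j)) i).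
    under [RHS]eq_bigr do rewrite !big_split/=.
    by rewrite !big_split/= F1 F2; ring.
  apply: ler_sum => i _; apply: ler_sum => j _.
  rewrite /F W1 W2 -!mulrDl -!natrD.
  have [i0|i0] := eqVneq i 0; first by rewrite /W i0 x0 !mul0r mulr0.
  have [j0|j0] := eqVneq j 0; first by rewrite /W j0 x0 mulr0 !mul0r mulr0.
  have [ij0|ij0] := eqVneq (i + j) 0; first by rewrite /W ij0 x0 !mulr0.
  rewrite ler_peMl// ler1n; have := charged_cyclic i0 j0 ij0; lia.
(* Arithmetic-geometric mean inequality between [x (i + j)] and [x i * x j]. *)
have step2 : \sum_i \sum_j F i j <=
    2^-1 * (\sum_i \sum_j (charged i j)%:R * x (i + j) ^+ 2)
    + 2^-1 * (\sum_i \sum_j (charged i j)%:R * (x i ^+ 2 * x j ^+ 2)).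
  rewrite !mulr_sumr -big_split; apply: ler_sum => i _.
  rewrite !mulr_sumr -big_split; apply: ler_sum => j _ /=.
  rewrite [leRHS](_ : _ = (charged i j)%:R *
    (2^-1 * (x (i + j) ^+ 2 + x i ^+ 2 * x j ^+ 2))); last by ring.
  apply: ler_wpM2l => //; rewrite /W.
  have := sqr_ge0 (x (i + j) - x i * x j); nra.
have step3 : \sum_i \sum_j (charged i j)%:R * x (i + j) ^+ 2 <=
    2 * (\sum_i ((psi i)%:R - 1) * x i ^+ 2).
  have -> : \sum_i \sum_j (charged i j)%:R * x (i + j) ^+ 2 =
     \sum_m \sum_i (charged i (m - i))%:R * x m ^+ 2.
    rewrite [RHS]exchange_big; apply: eq_bigr => i _ /=.
    rewrite [RHS](reindex_inj (h := fun j => i + j))/=; last exact: addrI.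
    by apply: eq_bigr => j _; rewrite [i + j - i]addrC addKr.
  rewrite mulr_sumr; apply: ler_sum => m _; rewrite -mulr_suml mulrA.
  have [->|m0] := eqVneq m 0; first by rewrite x0 expr0n !mulr0.
  apply: ler_wpM2r; first exact: sqr_ge0.
  rewrite -natr_sum -[X in _ - X]/(1%:R) -natrB ?lt0n ?zlength_eq0// -natrM ler_nat.
  rewrite subn1; apply: leq_trans (card_charged m0).
  by rewrite -sum1dep_card [leqRHS]big_mkcond; apply: leq_sum => i _; case: charged.
have step4 : \sum_i \sum_j (charged i j)%:R * (x i ^+ 2 * x j ^+ 2) <=
    2^-1 * (\sum_i x i ^+ 2) ^+ 2.
  (* The doubled sum is the sum plus its image under [j -> - j], and at most one of the two terms at
     each (i, j) is charged. *)
  rewrite -ler_pdivrMl ?invr_gt0// invrK mulr_natl mulr2n.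
  rewrite {2}[\sum_i \sum_j _](_ : _ =
    \sum_i \sum_j (charged i (- j))%:R * (x i ^+ 2 * x j ^+ 2)).
    rewrite -big_split expr2 mulr_suml; apply: ler_sum => i _.
    rewrite -big_split mulr_sumr; apply: ler_sum => j _ /=.
    rewrite -mulrDl -natrD; apply: ler_piMl; first by rewrite mulr_ge0 ?sqr_ge0.
    by rewrite -[X in _ <= X]/(1%:R) ler_nat charged_opp.
  apply: eq_bigr => i _; rewrite [RHS](reindex_inj (h := -%R))/=; last exact: oppr_inj.
  by apply: eq_bigr => j _; rewrite opprK xN.
move: step1 step2 step3 step4; lra.
Qed.

End WordLength.

(** * Fourier analysis on Z_n *)

Section Fourier.
Variables (R : realType) (n' : nat).
Local Notation n := n'.+4.
Implicit Types (k x y : 'Z_n) (u v : 'Z_n -> R) (f g : 'Z_n -> R[i]) (m : nat -> R).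


Definition chr k x : R[i] := expi (angle R n k x).

Arguments chr : simpl never.

Lemma chrC k x : chr k x = chr x k. Proof. by rewrite /chr angleC. Qed.

Lemma chr0 k : chr k 0 = 1.
Proof. by rewrite /chr /angle/= mulr0 mul0r expi0. Qed.

Lemma chrD k x y : chr k (x + y) = chr k x * chr k y.
Proof.
rewrite /chr -expiD val_addZ; case: ifP => h.
  by congr expi; rewrite /angle natrD; field.
rewrite -[LHS]mulr1 -(expi_2pi R k) -expiD; congr expi.
by rewrite /angle natrB ?natrD; [field|lia].
Qed.

Lemma chrN k x : chr k (- x) = expi (- angle R n k x).
Proof.
have h : chr k x * chr k (- x) = 1 by rewrite -chrD subrr chr0.
have h' : chr k x * expi (- angle R n k x) = 1 by rewrite /chr -expiD subrr expi0.
have c0 : chr k x != 0.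
  by apply/eqP => c0; move/eqP: h; rewrite c0 mul0r eq_sym oner_eq0.
by apply: (mulfI c0); rewrite h h'.
Qed.

Lemma chrNl k x : chr (- k) x = chr k (- x).
Proof. by rewrite chrC chrN angleC -chrN. Qed.

Lemma expiN (a : R) : expi (- a) = (expi a)^*%C.
Proof. by rewrite /expi cosN sinN. Qed.

Lemma chr_conj k x : chr k (- x) = (chr k x)^*%C.
Proof. by rewrite chrN expiN. Qed.

Lemma fourier_coefE f k : fourier_coef f k = (n%:R)^-1 * \sum_x f x * chr k (- x).
Proof. by rewrite /fourier_coef; under [in RHS]eq_bigr do rewrite chrN. Qed.

(** The pairing is bilinear, so frequency [k] meets [- k] and no conjugate appears. Parseval's
    identity, the cubic expansion and the spectral form of the energy all come from it. *)
Lemma mean_multiplier m f g :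
  n%:R^-1 * \sum_x g x * fourier_multiplier m f x =
  \sum_(k : 'Z_n) (m k)%:C * fourier_coef f k * fourier_coef g (- k)%R.
Proof.
rewrite /fourier_multiplier.
under eq_bigr do rewrite mulr_sumr.
rewrite exchange_big mulr_sumr; apply: eq_bigr => k _.
rewrite (fourier_coefE g) [RHS]mulrCA; congr (_ * _).
rewrite mulr_sumr; apply: eq_bigr => x _.
by rewrite chrNl opprK /chr; ring.
Qed.

Lemma parseval f g :
  n%:R^-1 * \sum_x g x * f x = \sum_(k : 'Z_n) fourier_coef f k * fourier_coef g (- k)%R.
Proof.
have := mean_multiplier (fun=> 1) f g; rewrite fourier_inversion// => ->.
by apply: eq_bigr => k _; rewrite mul1r.
Qed.

Lemma fourier_coef_sqr f k : fourier_coef (fun x => f x * f x) (- k)%R =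
  \sum_(j : 'Z_n) fourier_coef f j * fourier_coef f (- (k + j))%R.
Proof.
rewrite fourier_coefE; under eq_bigr do rewrite mulrAC.
rewrite parseval; apply: eq_bigr => j _; congr (_ * _).
rewrite !fourier_coefE; congr (_ * _); apply: eq_bigr => x _.
by rewrite -mulrA; congr (_ * _); rewrite !chrNl !opprK -chrC (chrC j) -chrD chrC.
Qed.

(** Parseval's identity for f^2 and f, the coefficients of f^2 being a convolution. *)
Lemma mean_cube f : n%:R^-1 * \sum_x f x ^+ 3 =
  \sum_(i : 'Z_n) \sum_(j : 'Z_n)
     fourier_coef f i * fourier_coef f j * fourier_coef f (- (i + j))%R.
Proof.
rewrite (eq_bigr (fun x => (f x * f x) * f x)); last by move=> x _; ring.
rewrite parseval; apply: eq_bigr => i _; rewrite fourier_coef_sqr mulr_sumr.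
by apply: eq_bigr => j _; rewrite mulrA.
Qed.

Definition rfun u x : R[i] := (u x)%:C.

Lemma fourier_coef_conj u k : fourier_coef (rfun u) (- k)%R = (fourier_coef (rfun u) k)^*%C.
Proof.
rewrite !fourier_coefE rmorphM rmorph_sum fmorphV rmorph_nat; congr (_ * _).
apply: eq_bigr => x _; rewrite rmorphM chrNl opprK chr_conj; congr (_ * _).
  exact: esym (conjc_real _).
exact: esym (conjcK _).
Qed.

(** Taking real parts makes the convolution kernel real by construction. For an even symbol nothing
    is lost, as the imaginary parts at [k] and [- k] cancel. *)
Definition ckernel m x : R := n%:R^-1 * \sum_(k : 'Z_n) m k * complex.Re (chr k x).

Definition convol m u x : R := \sum_y ckernel m (x - y) * u y.

Definition even_symbol m := forall k : 'Z_n, m (- k)%R = m k.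

Lemma Re2C (z : R[i]) : (complex.Re z)%:C + (complex.Re z)%:C = z + (z^*)%C.
Proof. by case: z => a b; apply/eqP; rewrite eq_complex /= addr0 subrr !eqxx. Qed.

Lemma ckernelC m x : even_symbol m ->
  (ckernel m x)%:C = n%:R^-1 * \sum_(k : 'Z_n) (m k)%:C * chr k x.
Proof.
move=> mN; rewrite /ckernel rmorphM rmorph_sum/= fmorphV rmorph_nat; congr (_ * _).
pose S := \sum_(k : 'Z_n) (m k)%:C * chr k x; rewrite -/S.
have SE : S = \sum_(k : 'Z_n) (m k)%:C * (chr k x)^*%C.
  rewrite /S (reindex_inj (h := -%R))/=; last exact: oppr_inj.
  by apply: eq_bigr => k _; rewrite mN chrNl chr_conj.
(* Adding to the sum its reflection in [k] turns each character into twice its real part. *)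
apply: (@mulfI _ 2%:R); first by rewrite pnatr_eq0.
rewrite mulr_natl [RHS]mulr_natl !mulr2n {2}SE /S -!big_split/=; apply: eq_bigr => k _.
rewrite rmorphM -!mulrDr. congr (_ * _).
exact: (Re2C (chr k x)).
Qed.

Lemma multiplierE m f x : even_symbol m ->
  fourier_multiplier m f x = \sum_y (ckernel m (x - y))%:C * f y.
Proof.
move=> mN; under [RHS]eq_bigr do rewrite ckernelC//.
rewrite /fourier_multiplier /=.
under eq_bigr => k _ do rewrite fourier_coefE !mulr_sumr mulr_suml.
rewrite exchange_big; apply: eq_bigr => y _ /=.
rewrite mulr_sumr mulr_suml; apply: eq_bigr => k _.
by rewrite chrD /chr; ring.
Qed.

Lemma multiplier_rfun m u : even_symbol m ->
  fourier_multiplier m (rfun u) = rfun (convol m u).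
Proof.
move=> mN; apply/funext => x; rewrite multiplierE// /rfun rmorph_sum/=.
by apply: eq_bigr => y _; rewrite [RHS]rmorphM.
Qed.

Definition mean u : R := n%:R^-1 * \sum_(x : 'Z_n) u x.

Lemma mean_rfun u : (mean u)%:C = n%:R^-1 * \sum_(x : 'Z_n) rfun u x.
Proof. by rewrite /mean rmorphM rmorph_sum fmorphV rmorph_nat. Qed.

Lemma mulc_conj (z : R[i]) : z * (z^*)%C = (normc z ^+ 2)%:C.
Proof.
case: z => a b; rewrite /normc sqr_sqrtr ?addr_ge0 ?sqr_ge0//.
by apply/eqP; rewrite eq_complex /=; apply/andP; split; apply/eqP; ring.
Qed.

Lemma mean_convol m u : even_symbol m ->
  mean (fun x => u x * convol m u x) =
  \sum_(k : 'Z_n) m k * normc (fourier_coef (rfun u) k) ^+ 2.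
Proof.
move=> mN; apply: (@complexI R); rewrite mean_rfun [RHS]rmorph_sum/=.
transitivity (n%:R^-1 * \sum_x rfun u x * fourier_multiplier m (rfun u) x).
  rewrite multiplier_rfun//; congr (_ * _); apply: eq_bigr => x _.
  by rewrite /rfun rmorphM.
rewrite mean_multiplier; apply: eq_bigr => k _.
by rewrite fourier_coef_conj -mulrA mulc_conj [RHS]rmorphM.
Qed.

Lemma mean_sqr u :
  mean (fun x => u x ^+ 2) = \sum_(k : 'Z_n) normc (fourier_coef (rfun u) k) ^+ 2.
Proof.
have := @mean_convol (fun=> 1) u (fun=> erefl).
under [in RHS]eq_bigr do rewrite mul1r; move<-; congr mean; apply/funext => x.
have /(congr1 (fun f => f x)) := @multiplier_rfun (fun=> 1) u (fun=> erefl).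
by rewrite fourier_inversion// => /complexI <-.
Qed.

Lemma Re_le_normc (z : R[i]) : complex.Re z <= normc z.
Proof.
case: z => a b /=; apply: le_trans (ler_norm a) _.
by rewrite -sqrtr_sqr ler_wsqrtr// lerDl sqr_ge0.
Qed.

Lemma le_normc_sum (I : Type) (r : seq I) (P : pred I) (F : I -> R[i]) :
  normc (\sum_(i <- r | P i) F i) <= \sum_(i <- r | P i) normc (F i).
Proof.
elim/big_ind2: _ => [|x1 x2 y1 y2 h1 h2|//]; first by rewrite normc0.
exact: le_trans (le_normcD _ _) (lerD h1 h2).
Qed.

(** Triangle inequality in the cubic expansion; as [u] is real, the moduli at [- (i + j)] and
    [i + j] agree. The right-hand side has the shape of [triple_sum_le]. *)
Lemma mean_cube_le u (x := fun k : 'Z_n => normc (fourier_coef (rfun u) k)) :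
  mean (fun y => u y ^+ 3) <= \sum_i \sum_j x i * x j * x (i + j).
Proof.
have xN k : x (- k) = x k.
  by rewrite /x fourier_coef_conj; case: (fourier_coef _ _) => a b /=; rewrite sqrrN.
have h : (mean (fun y => u y ^+ 3))%:C = \sum_(i : 'Z_n) \sum_(j : 'Z_n)
     fourier_coef (rfun u) i * fourier_coef (rfun u) j *
     fourier_coef (rfun u) (- (i + j))%R.
  rewrite mean_rfun -mean_cube; congr (_ * _); apply: eq_bigr => y _.
  by rewrite /rfun rmorphXn.
have -> : mean (fun y => u y ^+ 3) = complex.Re ((mean (fun y => u y ^+ 3))%:C) by [].
rewrite h; apply: le_trans (Re_le_normc _) _; apply: le_trans (le_normc_sum _ _ _) _.
apply: ler_sum => i _; apply: le_trans (le_normc_sum _ _ _) _.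
by apply: ler_sum => j _; rewrite -(xN (i + j)) 2!normcM.
Qed.

Lemma fourier_coef0 u : fourier_coef (rfun u) 0 = (mean u)%:C.
Proof.
rewrite mean_rfun -[0%N in LHS]/(nat_of_ord (0 : 'Z_n)) fourier_coefE.
by congr (_ * _); apply: eq_bigr => x _; rewrite chrC chr0 mulr1.
Qed.

End Fourier.
Arguments chr : simpl never.

(** * Calculus *)

Section Calculus.
Local Open Scope classical_set_scope.
Local Open Scope ring_scope.
Variable R : realType.
Implicit Types (f g : R -> R) (a b x y df dg : R).

Lemma is_derive1_cst x a : is_derive x 1 (fun=> a) 0.
Proof. exact: is_derive_cst. Qed.

Lemma is_derive1_id x : is_derive x 1 (fun y => y) 1.
Proof. exact: is_derive_id. Qed.

Lemma is_derive1_add f g x df dg : is_derive x 1 f df -> is_derive x 1 g dg ->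
  is_derive x 1 (fun y => f y + g y) (df + dg).
Proof. exact: is_deriveD. Qed.

Lemma is_derive1_mul f g x df dg : is_derive x 1 f df -> is_derive x 1 g dg ->
  is_derive x 1 (fun y => f y * g y) (f x * dg + g x * df).
Proof. exact: is_deriveM. Qed.

Lemma is_derive1_scale f x c df : is_derive x 1 f df ->
  is_derive x 1 (fun y => c * f y) (c * df).
Proof. exact: is_deriveZ. Qed.

Lemma is_derive1_inv f x df : f x != 0 -> is_derive x 1 f df ->
  is_derive x 1 (fun y => (f y)^-1) (- (f x) ^- 2 * df).
Proof. exact: is_deriveV. Qed.

Lemma is_derive1_sum m (f : 'I_m -> R -> R) (df : 'I_m -> R) x :
  (forall i, is_derive x 1 (f i) (df i)) ->
  is_derive x 1 (fun y => \sum_(i < m) f i y) (\sum_(i < m) df i).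
Proof.
move=> dfi; rewrite (_ : (fun _ => _) = \sum_(i < m) f i); first exact: is_derive_sum.
by apply/funext => y; rewrite fct_sumE.
Qed.

Lemma is_derive1_expR f x df : is_derive x 1 f df ->
  is_derive x 1 (fun y => expR (f y)) (expR (f x) * df).
Proof. by move=> h; apply: is_derive1_comp. Qed.

Lemma is_derive1_log f x df : 0 < f x -> is_derive x 1 f df ->
  is_derive x 1 (fun y => ln (f y)) ((f x)^-1 * df).
Proof. by move=> fx h; apply: is_derive1_comp; exact: is_derive1_ln. Qed.

Lemma is_derive_MVT f (f' : R -> R) a b : a <= b ->
  (forall x, a <= x <= b -> is_derive x 1 f (f' x)) ->
  exists2 c, a <= c <= b & f b - f a = f' c * (b - a).
Proof.
move=> ab h; have [||c] := @MVT_segment R f f' a b ab.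
- by move=> x; rewrite in_itv /= => /andP[/ltW ? /ltW ?]; apply: h; apply/andP.
- by apply: derivable_within_continuous => x; rewrite in_itv/= => /h [].
- by rewrite in_itv/=; exists c.
Qed.

(** Divided by x^2, the difference of the two sides is [G]. It vanishes at 1, and its derivative
    (2/3) ((y - 1) / y)^3 has the sign of y - 1, so 1 is its minimum. *)
Lemma sqr_ln_le_cubic x : 0 < x ->
  x ^+ 2 * (2 * ln x) <= 2 / 3 * x ^+ 3 + x ^+ 2 - 2 * x + 1 / 3.
Proof.
move=> x0.
pose G y : R := 2 / 3 * y + (-2 * y^-1 + (1 / 3 * (y^-1 * y^-1) + (-2 * ln y + 1))).
pose G' y : R := 2 / 3 * ((y - 1) * y^-1) ^+ 3.
have dG y : 0 < y -> is_derive y 1 G (G' y).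
  move=> y0; have y1 : y != 0 by rewrite gt_eqF.
  have dV : is_derive y 1 (fun z : R => z^-1) (- y ^- 2 * 1) by exact: is_derive1_inv.
  have h := is_derive1_add (is_derive1_scale (2 / 3) (is_derive1_id y))
    (is_derive1_add (is_derive1_scale (-2) dV)
    (is_derive1_add (is_derive1_scale (1 / 3) (is_derive1_mul dV dV))
      (is_derive1_add (is_derive1_scale (-2) (is_derive1_ln y0))
        (is_derive1_cst y 1)))).
  apply: (is_derive_eq h).
  by rewrite /G'; field.
have G_ge0 : 0 <= G x.
  have G1 : G 1 = 0 by rewrite /G ln1 invr1; field.
  rewrite -[G x]subr0 -[X in _ - X]G1; have [x1|/ltW x1] := leP 1 x.
    have [|c /andP[c1 _] ->] := is_derive_MVT x1 (f := G) (f' := G').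
      by move=> y /andP[y1 _]; apply: dG; lra.
    apply: mulr_ge0; last by rewrite subr_ge0.
    by rewrite /G' pmulr_rge0// exprn_ge0// divr_ge0 ?subr_ge0//; lra.
  have [|c /andP[xc c1] h] := is_derive_MVT x1 (f := G) (f' := G').
    by move=> y /andP[y1 _]; apply: dG; lra.
  rewrite -opprB h -mulrN opprB mulr_le0// ?subr_le0// /G' pmulr_rle0//.
  by rewrite exprn_odd_le0// pmulr_lle0 ?subr_le0// invr_gt0 (lt_le_trans x0).
have -> : 2 / 3 * x ^+ 3 + x ^+ 2 - 2 * x + 1 / 3 = x ^+ 2 * (2 * ln x) + x ^+ 2 * G x.
  by rewrite /G; field; rewrite gt_eqF.
by rewrite lerDl mulr_ge0 ?sqr_ge0.
Qed.

(** This is the Cauchy-Schwarz inequality for the integral of y^(q/2 - 1) between [b] and [a],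
    proved in discriminant form with the mean value theorem in place of integration. *)
Lemma stroock_varopoulos a b (q : R) : 1 < q -> 0 < a -> 0 < b ->
  (a `^ (q / 2) - b `^ (q / 2)) ^+ 2 <=
  q ^+ 2 / (4 * (q - 1)) * ((a - b) * (a `^ (q - 1) - b `^ (q - 1))).
Proof.
move=> q1; wlog ba : a b / b <= a.
  move=> H a0 b0; have [ba|/ltW ab] := leP b a; first exact: H.
  by rewrite -sqrrN opprB -[(a - b) * _]mulrNN !opprB; exact: H.
move=> a0 b0; move: ba; rewrite le_eqVlt => /predU1P[->|ba].
  by rewrite !subrr mul0r mulr0 expr0n.
pose X := a `^ (q / 2) - b `^ (q / 2).
(* For every l the function M is nondecreasing, its derivative being a square;
   this l minimises M a - M b. *)
pose l := 2 / q * X / (a - b).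
pose M y := l ^+ 2 * y + (- (4 * l / q) * y `^ (q / 2) + (q - 1)^-1 * y `^ (q - 1)).
have [q0 q10] : q != 0 /\ q - 1 != 0 by rewrite !gt_eqF//; lra.
have ab0 : a - b != 0 by rewrite gt_eqF//; lra.
have [|c _ h] := is_derive_MVT (ltW ba) (f := M)
  (f' := fun y => (l - y `^ (q / 2 - 1)) ^+ 2).
  move=> y /andP[yb _]; have y0 : 0 < y by apply: lt_le_trans yb.
  have dh := is_derive1_add (is_derive1_scale (l ^+ 2) (is_derive1_id y))
    (is_derive1_add (is_derive1_scale (- (4 * l / q)) (is_derive1_powR (q / 2) y0))
      (is_derive1_scale (q - 1)^-1 (is_derive1_powR (q - 1) y0))).
  apply: (is_derive_eq dh).
  have -> : y `^ (q - 1 - 1) = y `^ (q / 2 - 1) ^+ 2.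
    by rewrite -powR_mulrn ?powR_ge0// -powRrM; congr (_ `^ _); field.
  by field; rewrite q0 q10.
have : 0 <= M a - M b by rewrite h mulr_ge0 ?sqr_ge0// subr_ge0 ltW.
have -> : M a - M b = 4 / q ^+ 2 / (a - b) *
    (q ^+ 2 / (4 * (q - 1)) * ((a - b) * (a `^ (q - 1) - b `^ (q - 1))) - X ^+ 2).
  rewrite /M /l /X.
  move: (a `^ (q / 2)) (b `^ (q / 2)) (a `^ (q - 1)) (b `^ (q - 1)) => A B A1 B1.
  by field; rewrite ?ab0 ?q10 ?q0.
rewrite pmulr_rge0 ?subr_ge0//.
by rewrite !divr_gt0 ?subr_gt0// exprn_gt0; lra.
Qed.

(** If [d] were negative, [f'] would be negative just to the right of 0, and the mean value theorem
    would put [f] below [f 0] there. *)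
Lemma second_derivative_test f (f' : R -> R) (d e : R) : 0 < e ->
  (forall x, 0 <= x < e -> is_derive x 1 f (f' x)) -> f' 0 = 0 ->
  is_derive (0 : R) 1 f' d ->
  (forall x, 0 < x < e -> f 0 <= f x) -> 0 <= d.
Proof.
move=> e0 df f'0 [df' <-] fmin; rewrite leNgt; apply/negP => d0.
have : \forall h \near (0 : R)^', h^-1 *: (f' (h *: 1 + 0) - f' 0) < 0.
  have h : (fun h => h^-1 *: (f' (h *: 1 + 0) - f' 0)) @ (0 : R)^' -->
    ('D_1 f' 0 : R) := df'.
  exact: (cvgr_lt _ h _ d0).
rewrite near_withinE => /nbhs_ballP[r /= r0 hr].
pose x := Num.min (e / 2) (r / 2).
have x0 : 0 < x by rewrite lt_min !divr_gt0.
have xe : x < e by rewrite /x gt_min; apply/orP; left; lra.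
have xr : x < r by rewrite /x gt_min; apply/orP; right; lra.
have cn y : 0 <= y <= x -> is_derive y 1 f (f' y).
  by move=> /andP[y0 yx]; apply: df; rewrite y0 (le_lt_trans yx).
have [||c] := @MVT R f f' 0 x x0.
- by move=> y; rewrite in_itv/= => /andP[y0 yx]; apply: cn; rewrite !ltW.
- by apply: derivable_within_continuous => y; rewrite in_itv/= => /cn [].
- rewrite in_itv/= => /andP[c0 cx] h.
  have : c^-1 * (f' c - f' 0) < 0.
    have := hr c; rewrite /ball/= sub0r normrN gtr0_norm// => /(_ (lt_trans cx xr)).
    by rewrite gt_eqF// => /(_ isT); rewrite /GRing.scale/= mulr1 addr0.
  rewrite f'0 subr0 pmulr_rlt0 ?invr_gt0// => hc.
  have := fmin x; rewrite x0 xe => /(_ isT); rewrite -subr_ge0 h subr0.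
  by rewrite leNgt pmulr_llt0// hc.
Qed.

(** Derivative of the logarithm of an L^w norm when both exponent and function move. The factor of
    [dw] is the entropy of u^w; along the heat flow the other term becomes minus an energy. Gross's
    argument needs a moving exponent, the converse a constant one. *)
Lemma is_derive_log_sum m (u : 'I_m.+1 -> R -> R) (du : 'I_m.+1 -> R)
  (w : R -> R) (dw c s : R)
  (e := fun i r => expR (w r * ln (u i r))) (Z := c * \sum_i e i s) :
  0 < c -> w s != 0 -> (forall i, 0 < u i s) -> is_derive s 1 w dw ->
  (forall i, is_derive s 1 (u i) (du i)) ->
  is_derive s 1 (fun r => (w r)^-1 * ln (c * \sum_i e i r))
   ((w s)^-2 * Z^-1 * (dw * (c * \sum_i e i s * (w s * ln (u i s)) - Z * ln Z)
     + w s ^+ 2 * (c * \sum_i e i s / u i s * du i))).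
Proof.
move=> c0 w0 us dws dus.
have Z0 : 0 < Z.
  by rewrite mulr_gt0// big_ord_recl ltr_pwDl ?expR_gt0// sumr_ge0// => i _; exact: expR_ge0.
have de i : is_derive s 1 (e i) (e i s * (w s * ((u i s)^-1 * du i) + ln (u i s) * dw)).
  by apply: is_derive1_expR; apply: is_derive1_mul => //; exact: is_derive1_log.
have h := is_derive1_mul (is_derive1_inv w0 dws)
   (is_derive1_log (f := fun r => c * \sum_i e i r) Z0
     (is_derive1_scale c (is_derive1_sum de))).
apply: (is_derive_eq h); rewrite -/Z.
have -> : \sum_i e i s * (w s * ((u i s)^-1 * du i) + ln (u i s) * dw) =
   w s * (\sum_i e i s / u i s * du i) + dw / w s * (\sum_i e i s * (w s * ln (u i s))).
  by rewrite !mulr_sumr -big_split; apply: eq_bigr => i _ /=; field; rewrite ?w0 ?gt_eqF.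
by field; rewrite w0 gt_eqF.
Qed.

End Calculus.

(** * Multiplier kernels and the Dirichlet form *)

Section DirichletForm.
Variables (R : realType) (n' : nat).
Local Notation n := n'.+4.
Implicit Types (k x y : 'Z_n) (u v : 'Z_n -> R) (m : nat -> R).

Definition wlen (j : nat) : R := (word_length n j)%:R.

Lemma even_word_length (g : nat -> R) : even_symbol n' (g \o word_length n).
Proof. by move=> k; congr (g _); exact: zlengthN. Qed.

Lemma Re_chr_lt1 x : x != 0 -> complex.Re (chr R 1 x) < 1.
Proof.
move=> x0; rewrite lt_neqAle cos_le1 andbT; apply/eqP => c1.
have := @expi_angle_neq1 R n isT x 0.
rewrite lt0n -eqZ0 x0 ltZ => /(_ isT)/eqP; apply.
rewrite [X in _ - X](_ : _ = 0) ?subr0; last by rewrite /angle mulr0 !mul0r.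
have := cos2Dsin2 (angle R n 1%N x); rewrite [cos _]c1 expr1n => h.
have /eqP : sin (angle R n 1%N x) ^+ 2 = 0 by move: h; lra.
rewrite sqrf_eq0 => /eqP s0.
by rewrite angleC /expi s0 [cos _]c1.
Qed.

(** A discrete version of Pólya's criterion, applied to minus the word length and to the heat
    symbol. *)
Lemma ckernel_ge0 m x :
  (forall k, k != 0 -> 2 * m k <= m (k + 1 : 'Z_n)%R + m (k - 1 : 'Z_n)%R) ->
  x != 0 -> 0 <= ckernel m x.
Proof.
move=> mconv x0; rewrite /ckernel mulr_ge0 ?invr_ge0//.
pose c k : R := complex.Re (chr R k x).
rewrite -/(\sum_(k : 'Z_n) m k * c k).
have cE k : c (k + 1) + c (k - 1) = 2 * c 1 * c k.
  rewrite /c chrC chrD [chr R (k - 1) x]chrC chrD chr_conj (chrC R x k) (chrC R x 1).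
  by case: (chr R k x) (chr R 1 x) => a b [a' b'] /=; ring.
pose L k : R := m (k + 1 : 'Z_n)%R + m (k - 1 : 'Z_n)%R - 2 * m k.
(* Summation by parts: d = c turns the second difference L of m into the
   negative factor 2 cos - 2, and d = 1 shows that L has sum 0. *)
have SD (d : 'Z_n -> R) : \sum_k L k * d k =
    \sum_(k : 'Z_n) m k * (d (k + 1) + d (k - 1) - 2 * d k).
  have S1 : \sum_(k : 'Z_n) m (k + 1 : 'Z_n)%R * d k = \sum_(k : 'Z_n) m k * d (k - 1).
    by rewrite [RHS](reindex_inj (addIr 1)); apply: eq_bigr => k _; rewrite addrK.
  have S2 : \sum_(k : 'Z_n) m (k - 1 : 'Z_n)%R * d k = \sum_(k : 'Z_n) m k * d (k + 1).
    by rewrite [RHS](reindex_inj (addIr (- 1))); apply: eq_bigr => k _; rewrite subrK.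
  rewrite /L; under eq_bigr do rewrite mulrBl mulrDl.
  rewrite sumrB big_split S1 S2 -big_split -sumrB; apply: eq_bigr => k _.
  by move: (m k) (d (k - 1)) (d (k + 1)) (d k) => *; rewrite /=; ring.
have SE : (2 * c 1 - 2) * \sum_(k : 'Z_n) m k * c k = \sum_k L k * c k.
  by rewrite SD mulr_sumr; apply: eq_bigr => k _; rewrite cE; ring.
have : \sum_k L k * c k <= 0.
  have L0 : \sum_k L k * 1 = 0 by rewrite (SD (fun=> 1)); apply: big1 => k _; ring.
  rewrite -[leRHS]L0; apply: ler_sum => k _; have [->|k0] := eqVneq k 0.
    by rewrite /c chrC chr0 !mulr1.
  by rewrite ler_wpM2l ?cos_le1// /L subr_ge0 mconv.
rewrite -SE nmulr_rle0// subr_lt0 gtr_pMr// Re_chr_lt1//.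
Qed.

Lemma ckernelN m x : ckernel m (- x) = ckernel m x.
Proof.
rewrite /ckernel; congr (_ * _); apply: eq_bigr => k _; congr (_ * _).
by rewrite chr_conj; case: (chr R k x).
Qed.

Lemma sum_Re_chr k : \sum_x complex.Re (chr R k x) = if k == 0 then n%:R else 0.
Proof.
have [->|k0] := eqVneq k 0.
  rewrite (eq_bigr (fun=> 1)) ?sumr_const ?card_ord// => x _.
  by rewrite chrC chr0.
have := @expi_orthogonal R n isT k 0 (ltZ k) isT.
rewrite (_ : (k == 0%N :> nat) = false) ?muln0; last exact/negbTE.
rewrite (eq_bigr (fun x : 'I_n => chr R k (x : 'Z_n))).
  by move=> /(congr1 (@complex.Re R)); rewrite raddf_sum.
move=> x _; rewrite /chr [angle R n 0 _](_ : _ = 0) ?oppr0 ?expi0 ?mulr1//.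
by rewrite /angle mulr0 !mul0r.
Qed.

Lemma sum_ckernel m : \sum_(x : 'Z_n) ckernel m x = m 0%N.
Proof.
rewrite /ckernel -mulr_sumr exchange_big.
under eq_bigr do rewrite -mulr_sumr sum_Re_chr.
rewrite (bigD1 (0 : 'Z_n))//= big1 ?addr0 => [|k /negPf->]; last by rewrite mulr0.
by rewrite mulrCA mulVf ?mulr1// pnatr_eq0.
Qed.

Definition energy u v : R := mean (fun x => u x * convol wlen v x).

(** On {0, ..., n} the word length is a minimum of two affine functions; only at frequency 0 does
    wrapping around create a convex corner. *)
Lemma wlen_concave k : k != 0 ->
  wlen (k + 1 : 'Z_n)%R + wlen (k - 1 : 'Z_n)%R <= 2 * wlen k.
Proof.
rewrite -natrD -natrM ler_nat eqZ0 /word_length !val_addZ val_oppZ; have := ltZ k.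
have -> : (1 : 'Z_n) = 1%N :> nat by [].
by rewrite /=; do 2 case: ifP; lia.
Qed.

Lemma wlen_ckernel_le0 x : x != 0 -> ckernel wlen x <= 0.
Proof.
move=> x0; have := @ckernel_ge0 (fun j => - wlen j) x.
have -> : ckernel (fun j => - wlen j) x = - ckernel wlen x.
  by rewrite /ckernel -mulrN -sumrN; under eq_bigr do rewrite mulNr.
rewrite oppr_ge0; apply=> // k k0.
by rewrite -opprD mulrN lerN2 wlen_concave.
Qed.

(** The kernel is even and has total mass psi(0) = 0, so the diagonal terms of the expanded product
    vanish. In this form, with nonnegative jump rates off the diagonal, inequalities between
    increments pass to energies. *)
Lemma energyE u v : energy u v =
  2^-1 * mean (fun x => \sum_y - ckernel wlen (x - y) * ((u x - u y) * (v x - v y))).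
Proof.
rewrite /energy /convol /mean; set K := ckernel _.
have K0 x : \sum_y K (x - y) = 0.
  rewrite (reindex_inj (h := fun y => x - y))/=; last by move=> a b /addrI /oppr_inj.
  under eq_bigr do rewrite subKr.
  by rewrite sum_ckernel /wlen /word_length min0n.
have KC x y : K (y - x) = K (x - y) by rewrite /K -[LHS]ckernelN opprB.
pose S := \sum_x \sum_y K (x - y) * (u x * v y).
have S1 : \sum_x u x * \sum_y K (x - y) * v y = S.
  by apply: eq_bigr => x _; rewrite mulr_sumr; apply: eq_bigr => y _; ring.
have S2 : \sum_x \sum_y K (x - y) * (u y * v x) = S.
  rewrite exchange_big; apply: eq_bigr => x _; apply: eq_bigr => y _.
  by rewrite KC.
have S3 : \sum_x \sum_y K (x - y) * (u x * v x) = 0.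
  by apply: big1 => x _; rewrite -mulr_suml K0 mul0r.
have S4 : \sum_x \sum_y K (x - y) * (u y * v y) = 0.
  rewrite exchange_big; apply: big1 => x _; rewrite -mulr_suml.
  by under eq_bigr do rewrite KC; rewrite K0 mul0r.
rewrite S1 mulrCA; congr (_ * _).
have -> : \sum_x \sum_y - K (x - y) * ((u x - u y) * (v x - v y)) =
   \sum_x \sum_y (K (x - y) * (u x * v y) + K (x - y) * (u y * v x) -
     K (x - y) * (u x * v x) - K (x - y) * (u y * v y)).
  by apply: eq_bigr => x _; apply: eq_bigr => y _; ring.
under eq_bigr do rewrite sumrB sumrB big_split/=.
by rewrite !sumrB big_split/= S2 S3 S4 -/S; field.
Qed.

Lemma le_mean u v : (forall x, u x <= v x) -> mean u <= mean v.
Proof. by move=> uv; rewrite ler_wpM2l ?invr_ge0// ler_sum. Qed.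

Lemma energy_stroock_varopoulos u (q : R) : 1 < q -> (forall x, 0 < u x) ->
  energy (fun x => u x `^ (q / 2)) (fun x => u x `^ (q / 2)) <=
  q ^+ 2 / (4 * (q - 1)) * energy (fun x => u x `^ (q - 1)) u.
Proof.
move=> q1 u0; rewrite !energyE [leRHS]mulrCA ler_wpM2l ?invr_ge0//.
rewrite /mean [leRHS]mulrCA ler_wpM2l ?invr_ge0// mulr_sumr ler_sum// => x _.
rewrite mulr_sumr ler_sum// => y _; rewrite [leRHS]mulrCA.
have [->|xy] := eqVneq x y; first by rewrite !subrr !(mulr0, mul0r).
rewrite ler_wpM2l ?oppr_ge0 ?wlen_ckernel_le0 ?subr_eq0//.
by rewrite -expr2 [X in _ <= _ * X]mulrC stroock_varopoulos.
Qed.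

Lemma energy_powR_ge0 u (q : R) : 1 < q -> (forall x, 0 < u x) ->
  0 <= energy (fun x => u x `^ (q - 1)) u.
Proof.
move=> q1 u0; have : 0 <= q ^+ 2 / (4 * (q - 1)) * energy (fun x => u x `^ (q - 1)) u.
  apply: le_trans (energy_stroock_varopoulos q1 u0).
  rewrite energyE mulr_ge0 ?invr_ge0// mulr_ge0 ?invr_ge0// sumr_ge0// => x _.
  rewrite sumr_ge0// => y _; have [->|xy] := eqVneq x y; first by rewrite !subrr !mulr0.
  by rewrite mulr_ge0 -?expr2 ?sqr_ge0// oppr_ge0 wlen_ckernel_le0 ?subr_eq0.
by rewrite pmulr_rge0// divr_gt0 ?exprn_gt0//; lra.
Qed.

End DirichletForm.

(** * The logarithmic Sobolev inequality *)

Section LogSobolev.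
Variables (R : realType) (n' : nat).
Local Notation n := n'.+4.
Local Notation wlen := (wlen R n').
Implicit Types (k x y : 'Z_n) (u v : 'Z_n -> R) (m : nat -> R).

Lemma meanD u v : mean (fun x => u x + v x) = mean u + mean v.
Proof. by rewrite /mean big_split mulrDr. Qed.

Lemma meanZ a u : mean (fun x => a * u x) = a * mean u.
Proof. by rewrite /mean -mulr_sumr mulrCA. Qed.

Lemma mean_cst (a : R) : mean (fun _ : 'Z_n => a) = a.
Proof. by rewrite /mean sumr_const card_ord -[a *+ _]mulr_natl mulKf// pnatr_eq0. Qed.

Lemma mean_gt0 u : (forall x, 0 < u x) -> 0 < mean u.
Proof.
move=> u0; rewrite /mean mulr_gt0// big_ord_recl ltr_pwDl// sumr_ge0// => i _.
exact: ltW.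
Qed.

Lemma even_wlen : even_symbol n' wlen.
Proof. exact: (even_word_length (fun j => j%:R)). Qed.

(** [triple_sum_le] for the moduli of the Fourier coefficients; centering makes the one at frequency
    0 vanish. By Parseval the weight psi - 1 yields energy minus variance. *)
Lemma mean_cube_centered_le u : mean u = 0 ->
  mean (fun x => u x ^+ 3) <=
  3 * (energy u u - mean (fun x => u x ^+ 2)) + 3 / 4 * mean (fun x => u x ^+ 2) ^+ 2.
Proof.
move=> u0; apply: le_trans (mean_cube_le _) _.
pose c k := normc (fourier_coef (rfun u) k).
apply: (le_trans (@triple_sum_le n' R c _ _ _)).
- by move=> k; rewrite /c; case: (fourier_coef _ _) => a b; exact: sqrtr_ge0.
- by rewrite /c fourier_coef0 u0 normc0.
- move=> k; rewrite /c fourier_coef_conj; case: (fourier_coef _ _) => a b /=.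
  by rewrite sqrrN.
rewrite /energy (mean_convol u even_wlen) mean_sqr -sumrB lerD2r ler_pM2l//.
by apply: ler_sum => k _; rewrite mulrBl mul1r.
Qed.

Lemma log_sobolev_unit u : (forall x, 0 < u x) -> mean (fun x => u x ^+ 2) = 1 ->
  mean (fun x => u x ^+ 2 * (2 * ln (u x))) <= 2 * energy u u.
Proof.
move=> u0 u1; set mu := mean u; pose h x := u x - mu.
have uE : u = fun x => h x + mu by apply/funext => x; rewrite subrK.
have h0 : mean h = 0.
  by rewrite /h meanD -/mu (mean_cst (- mu)) subrr.
have mu_gt0 : 0 < mu by exact: mean_gt0.
have h2 : mean (fun x => h x ^+ 2) = 1 - mu ^+ 2.
  have -> : (fun x => h x ^+ 2) = (fun x => u x ^+ 2 + (- (2 * mu) * u x + mu ^+ 2)).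
    by apply/funext => x; rewrite /h; ring.
  by rewrite !meanD meanZ u1 mean_cst -/mu; ring.
have u3 : mean (fun x => u x ^+ 3) =
    mean (fun x => h x ^+ 3) + 3 * mu * (1 - mu ^+ 2) + mu ^+ 3.
  have -> : (fun x => u x ^+ 3) =
     (fun x => h x ^+ 3 + (3 * mu * h x ^+ 2 + (3 * mu ^+ 2 * h x + mu ^+ 3))).
    by apply/funext => x; rewrite /h; ring.
  by rewrite 3!meanD 2!meanZ h2 h0 mean_cst; ring.
have eh : energy h h = energy u u.
  rewrite !energyE; congr (_ * mean _); apply/funext => x; apply: eq_bigr => y _.
  by congr (_ * (_ * _)); rewrite /h; ring.
have := mean_cube_centered_le h0; rewrite eh h2 => h3.
have : 0 <= mean (fun x => h x ^+ 2).
  by rewrite -(mean_cst 0); apply: le_mean => x; exact: sqr_ge0.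
rewrite h2 => mu1.
(* The cubic bound integrated, using that [u ^+ 2] has mean 1. *)
apply: (@le_trans _ _ (2 / 3 * mean (fun x => u x ^+ 3) + 1 - 2 * mu + 1 / 3)).
  have -> : 2 / 3 * mean (fun x => u x ^+ 3) + 1 - 2 * mu + 1 / 3 =
     mean (fun x => 2 / 3 * u x ^+ 3 + (u x ^+ 2 + (-2 * u x + 1 / 3))).
    by rewrite !meanD !meanZ u1 mean_cst -/mu; ring.
  by apply: le_mean => x; apply: le_trans (sqr_ln_le_cubic (u0 x)) _; lra.
have mu1' : mu <= 1 by nra.
(* Once the bounds on the cubes are inserted, the right-hand side is 2 [energy u u] minus one sixth
   of this polynomial. *)
have key : 0 <= (1 - mu) ^+ 3 * (1 + 3 * mu).
  by rewrite mulr_ge0 ?exprn_ge0//; lra.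
rewrite u3; nra.
Qed.

Lemma energyZ a u : energy (fun x => a * u x) (fun x => a * u x) = a ^+ 2 * energy u u.
Proof.
rewrite !energyE [RHS]mulrCA; congr (_ * _).
rewrite -meanZ; congr mean; apply/funext => x.
by rewrite mulr_sumr; apply: eq_bigr => y _; ring.
Qed.

(** Entropy and energy are both homogeneous of degree 2, so dividing [u] by the square root of [Z]
    reduces to the normalized case. *)
Lemma log_sobolev u (Z := mean (fun x => u x ^+ 2)) : (forall x, 0 < u x) ->
  mean (fun x => u x ^+ 2 * (2 * ln (u x))) - Z * ln Z <= 2 * energy u u.
Proof.
move=> u0.
have Z0 : 0 < Z by apply: mean_gt0 => x; rewrite exprn_gt0.
pose r := (Num.sqrt Z)^-1.
have r0 : 0 < r by rewrite invr_gt0 sqrtr_gt0.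
have r2 : r ^+ 2 = Z^-1 by rewrite exprVn sqr_sqrtr// ltW.
have lnr : 2 * ln r = - ln Z.
  by rewrite -lnV// -r2 lnXn// mulr_natl.
have := @log_sobolev_unit (fun x => r * u x).
have -> : mean (fun x => (r * u x) ^+ 2) = 1.
  transitivity (mean (fun x => r ^+ 2 * u x ^+ 2)).
    by congr mean; apply/funext => x; rewrite exprMn.
  by rewrite meanZ -/Z r2 mulVf// gt_eqF.
have -> : mean (fun x => (r * u x) ^+ 2 * (2 * ln (r * u x))) =
    Z^-1 * (mean (fun x => u x ^+ 2 * (2 * ln (u x))) - Z * ln Z).
  rewrite [Z * _]mulrC -mulNr -meanZ -meanD -meanZ; congr mean; apply/funext => x.
  by rewrite lnM ?posrE// exprMn r2 mulrDr lnr; ring.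
rewrite energyZ r2 mulrCA ler_pM2l ?invr_gt0//; apply=> // x.
exact: mulr_gt0.
Qed.

End LogSobolev.

(** * Heat flow of positive functions *)

Section Heat.
Variables (R : realType) (n' : nat).
Local Notation n := n'.+4.
Local Notation wlen := (wlen R n').
Implicit Types (k x y : 'Z_n) (u v : 'Z_n -> R) (m : nat -> R) (f : 'Z_n -> R[i]).

Definition heat (t : R) (j : nat) : R := expR (- t * wlen j).

Lemma semigroupE t f : semigroup t f = fourier_multiplier (heat t) f.
Proof. by []. Qed.

Lemma even_heat t : even_symbol n' (heat t).
Proof. exact: (even_word_length (fun j => expR (- t * j%:R))). Qed.

(** Off the diagonal, the heat symbol inherits convexity away from 0: factoring out its value at
    [k], the bound exp(z) >= 1 + z reduces this to concavity of the word length. On the diagonal the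
    kernel is a mean of positive numbers. *)
Lemma heat_ckernel_ge0 t x : 0 <= t -> 0 <= ckernel (heat t) x.
Proof.
move=> t0; have [->|x0] := eqVneq x 0.
  rewrite /ckernel mulr_ge0 ?invr_ge0// sumr_ge0// => k _.
  by rewrite chr0 mulr1 expR_ge0.
apply: ckernel_ge0 => // k k0; rewrite /heat.
set a := wlen (k + 1 : 'Z_n)%R; set b := wlen (k - 1 : 'Z_n)%R; set c := wlen k.
have abc : a + b <= 2 * c by exact: wlen_concave.
have E z : expR (- t * z) = expR (- t * c) * expR (- t * (z - c)).
  by rewrite -expRD; congr expR; ring.
rewrite (E a) (E b) -mulrDr mulrC ler_pM2l ?expR_gt0//.
apply: le_trans (lerD (expR_ge1Dx _) (expR_ge1Dx _)); nra.
Qed.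

Lemma heat_ckernel0_gt0 t : 0 < ckernel (n' := n') (heat t) 0.
Proof.
rewrite /ckernel mulr_gt0// big_ord_recl ltr_pwDl//.
  by rewrite chr0 mulr1 expR_gt0.
by rewrite sumr_ge0// => k _; rewrite chr0 mulr1 expR_ge0.
Qed.

Lemma convol_heat_gt0 t u x : 0 <= t -> (forall y, 0 < u y) -> 0 < convol (heat t) u x.
Proof.
move=> t0 u0; rewrite /convol (bigD1 x)//= subrr ltr_pwDl//.
  by rewrite mulr_gt0// heat_ckernel0_gt0.
by rewrite sumr_ge0// => y _; rewrite mulr_ge0 ?heat_ckernel_ge0// ltW.
Qed.

Lemma normc_rfun u x : normc (rfun u x) = `|u x|.
Proof. by rewrite /normc/= expr0n addr0 sqrtr_sqr. Qed.

(** Nonnegativity of the kernel lets the modulus pass inside; this reduces complex functions to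
    positive ones. *)
Lemma normc_semigroup_le t f u x : 0 <= t -> (forall y, normc (f y) <= u y) ->
  normc (semigroup t f x) <= convol (heat t) u x.
Proof.
move=> t0 fu; rewrite semigroupE multiplierE; last exact: even_heat.
apply: le_trans (le_normc_sum _ _ _) _; apply: ler_sum => y _.
rewrite normcM -[(_)%:C]/(rfun (ckernel (heat t)) (x - y)) normc_rfun.
by rewrite ger0_norm ?heat_ckernel_ge0// ler_wpM2l ?heat_ckernel_ge0.
Qed.

Lemma convol_comp m1 m2 u : even_symbol n' m1 -> even_symbol n' m2 ->
  convol m1 (convol m2 u) = convol (fun j => m1 j * m2 j) u.
Proof.
move=> e1 e2; apply/funext => x; apply: (@complexI R).
rewrite -[LHS]/(rfun (convol m1 (convol m2 u)) x) -[RHS]/(rfun (convol _ u) x).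
rewrite -!multiplier_rfun//; last by move=> k; rewrite e1 e2.
apply: eq_bigr => k _; rewrite fourier_coef_multiplier// mulrA.
by rewrite rmorphM.
Qed.

Lemma convol_heat0 u : convol (heat 0) u = u.
Proof.
apply/funext => x; apply: (@complexI R).
rewrite -[LHS]/(rfun (convol (heat 0) u) x) -multiplier_rfun; last exact: even_heat.
rewrite (_ : heat 0 = fun=> 1) ?fourier_inversion//.
by apply/funext => j; rewrite /heat oppr0 mul0r expR0.
Qed.

Lemma is_derive_heat u x (s : R) :
  is_derive s 1 (fun r => convol (heat r) u x) (- convol wlen (convol (heat s) u) x).
Proof.
have dh j : is_derive s 1 (fun r => heat r j) (expR (- s * wlen j) * (- wlen j)).
  apply: is_derive1_expR.
  have h := is_derive1_scale (- wlen j) (is_derive1_id s).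
  have -> : (fun r : R => - r * wlen j) = (fun r => - wlen j * r).
    by apply/funext => r; ring.
  by apply: (is_derive_eq h); rewrite mulr1.
have h := is_derive1_sum (fun y : 'I_(Zp_trunc n).+2 =>
  is_derive1_scale (u y) (is_derive1_scale n%:R^-1 (is_derive1_sum
    (fun k : 'I_(Zp_trunc n).+2 =>
      is_derive1_scale (complex.Re (chr R k (x - y))) (dh k))))).
have -> : (fun r => convol (heat r) u x) = (fun r : R => \sum_(i < (Zp_trunc n).+2)
   u i * (n%:R^-1 * \sum_(k < (Zp_trunc n).+2)
     complex.Re (chr R k (x - i)) * heat r k)).
  apply/funext => r; apply: eq_bigr => y _; rewrite mulrC; congr (_ * (_ * _)).
  by apply: eq_bigr => k _; rewrite mulrC.
apply: (is_derive_eq h); rewrite convol_comp; [|exact: even_wlen|exact: even_heat].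
rewrite /convol -sumrN; apply: eq_bigr => y _.
rewrite /ckernel mulrC -mulNr; congr (_ * _); rewrite -mulrN; congr (_ * _).
by rewrite -sumrN; apply: eq_bigr => k _; rewrite /heat; ring.
Qed.

(** The logarithm of the L^p norm of a positive function (see [pnorm_rfun]), with powers written as
    exponentials so that the exponent can be differentiated too. *)
Definition log_pnorm (p : R) u : R :=
  p^-1 * ln (mean (fun x => expR (p * ln (u x)))).

(** Gross's argument: the exponent w solves w' = 2c(w - 1). With the logarithmic Sobolev and
    Stroock-Varopoulos inequalities, the entropy term in the derivative is at most [c] times the
    energy term subtracted from it, so the log-norm does not increase when c <= 1. *)
Lemma log_pnorm_heat_le (p c t : R) u :
  1 < p -> 0 <= c <= 1 -> 0 <= t -> (forall x, 0 < u x) ->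
  log_pnorm (1 + (p - 1) * expR (2 * c * t)) (convol (heat t) u) <= log_pnorm p u.
Proof.
move=> p1 /andP[c0 c1] t0 u0.
pose w r : R := 1 + (p - 1) * expR (2 * c * r).
pose U x r := convol (heat r) u x.
have w1 r : 1 < w r by rewrite ltrDl mulr_gt0 ?expR_gt0 ?subr_gt0.
have dw (s : R) : is_derive s 1 w (2 * c * (w s - 1)).
  have h := is_derive1_add (is_derive1_cst s 1) (is_derive1_scale (p - 1)
    (is_derive1_expR (is_derive1_scale (2 * c) (is_derive1_id s)))).
  by apply: (is_derive_eq h); rewrite /w; ring.
pose F r := log_pnorm (w r) (convol (heat r) u).
have dF (s : R) : 0 <= s <= t -> exists2 d, d <= 0 & is_derive s 1 F d.
  move=> /andP[s0 _].
  have U0 x : 0 < U x s by exact: convol_heat_gt0.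
  have w0 : w s != 0 by rewrite gt_eqF// (lt_trans _ (w1 s)).
  have n0 : 0 < n%:R^-1 :> R by rewrite invr_gt0 ltr0n.
  have h := is_derive_log_sum n0 w0 U0 (dw s) (fun x => is_derive_heat u x s).
  eexists; last exact: h.
  set Z := n%:R^-1 * _.
  (* The square of [v] is U^w, so the logarithmic Sobolev inequality for [v] controls the entropy in
     the derivative. *)
  pose v x := U x s `^ (w s / 2).
  have v0 x : 0 < v x by exact: powR_gt0.
  have v2 x : v x ^+ 2 = expR (w s * ln (U x s)).
    rewrite -powR_mulrn ?ltW// -powRrM /powR gt_eqF//; congr expR.
    by congr (_ * _); field.
  have lnv x : 2 * ln (v x) = w s * ln (U x s).
    by rewrite /v ln_powR; field.
  have ZE : Z = mean (fun x => v x ^+ 2).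
    by congr (_ * _); apply: eq_bigr => x _; rewrite v2.
  have Z0 : 0 < Z by rewrite ZE mean_gt0// => x; rewrite exprn_gt0.
  have lsi := log_sobolev v0; rewrite -ZE in lsi.
  have -> : n%:R^-1 * \sum_i expR (w s * ln (U i s)) * (w s * ln (U i s)) =
     mean (fun x => v x ^+ 2 * (2 * ln (v x))).
    by congr (_ * _); apply: eq_bigr => x _; rewrite v2 lnv.
  have -> : n%:R^-1 * \sum_i expR (w s * ln (U i s)) / U i s *
       - convol wlen (convol (heat s) u) i =
     - energy (fun x => U x s `^ (w s - 1)) (fun x => U x s).
    rewrite /energy /mean -mulrN -sumrN; congr (_ * _); apply: eq_bigr => x _.
    rewrite mulrN powRB; last by rewrite gt_eqF ?implybT.
    by rewrite powRr1 ?ltW// /powR gt_eqF.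
  have sv := energy_stroock_varopoulos (w1 s) U0.
  have en0 := energy_powR_ge0 (w1 s) U0.
  rewrite pmulr_rle0; last first.
    by rewrite mulr_gt0 ?invr_gt0// exprn_gt0// (lt_trans _ (w1 s)).
  set Ent := mean _ - _ in lsi *.
  set E1 := energy _ _ in sv lsi; set E2 := energy _ _ in sv en0 *.
  have h1 : Ent <= w s ^+ 2 / (2 * (w s - 1)) * E2.
    apply: le_trans lsi _.
    have -> : w s ^+ 2 / (2 * (w s - 1)) * E2 = 2 * (w s ^+ 2 / (4 * (w s - 1)) * E2).
      by field; rewrite subr_eq0 gt_eqF.
    by rewrite ler_pM2l.
  have h2 : 2 * c * (w s - 1) * Ent <= c * (w s ^+ 2 * E2).
    have -> : c * (w s ^+ 2 * E2) = 2 * c * (w s - 1) * (w s ^+ 2 / (2 * (w s - 1)) * E2).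
      by field; rewrite subr_eq0 gt_eqF.
    by apply: ler_wpM2l => //; rewrite !mulr_ge0// subr_ge0 ltW.
  have h3 : c * (w s ^+ 2 * E2) <= w s ^+ 2 * E2.
    by rewrite ler_piMl// mulr_ge0// sqr_ge0.
  by rewrite mulrN subr_le0 (le_trans h2).
have -> : log_pnorm p u = F 0.
  by rewrite /F /w mulr0 expR0 mulr1 addrC subrK convol_heat0.
have [|c' ct' h] := @is_derive_MVT R F (fun s => ('D_1 F s)%classic) 0 t t0.
  by move=> s /dF[d _ [? _]]; exact: DeriveDef.
rewrite -subr_le0 h subr0 mulr_le0_ge0//.
by have [d d0 [_ ->]] := dF _ ct'.
Qed.

End Heat.

(** * Hypercontractivity *)

Section Hypercontractivity.
Variables (R : realType) (n' : nat).
Local Notation n := n'.+4.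
Local Notation heat := (@heat R n').
Implicit Types (k x y : 'Z_n) (u v : 'Z_n -> R) (m : nat -> R) (f g : 'Z_n -> R[i]).

Lemma mean_powR_ge0 (p : R) f : 0 <= mean (fun x => normc (f x) `^ p).
Proof. by rewrite /mean mulr_ge0 ?invr_ge0// sumr_ge0// => x _; exact: powR_ge0. Qed.

Lemma pnorm_powR (p : R) f : p != 0 -> pnorm p f `^ p = mean (fun x => normc (f x) `^ p).
Proof.
by move=> p0; rewrite /pnorm -powRrM mulVf// powRr1//; exact: mean_powR_ge0.
Qed.

Lemma normc_ge0 (z : R[i]) : 0 <= normc z.
Proof. by case: z => a b; exact: sqrtr_ge0. Qed.

Lemma le_powR (p a b : R) : 0 <= p -> 0 <= a -> a <= b -> a `^ p <= b `^ p.
Proof.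
by move=> p0 a0 ab; apply: ge0_ler_powR => //; rewrite nnegrE// (le_trans a0).
Qed.

Lemma powR_le_root (p a b : R) : 0 < p -> 0 <= a -> a `^ p <= b -> a <= b `^ p^-1.
Proof.
move=> p0 a0 ab; have pV0 : 0 <= p^-1 by rewrite invr_ge0 ltW.
have := le_powR pV0 (powR_ge0 _ _) ab.
by rewrite -powRrM mulfV ?gt_eqF// powRr1.
Qed.

Lemma le_pnorm (p : R) f g : 0 < p -> (forall x, normc (f x) <= normc (g x)) ->
  pnorm p f <= pnorm p g.
Proof.
move=> p0 fg; have p0' := ltW p0.
apply: le_powR; rewrite ?invr_ge0//; first exact: mean_powR_ge0.
by apply: le_mean => x; apply: le_powR => //; exact: normc_ge0.
Qed.

Lemma pnorm_rfun (p : R) u : (forall x, 0 < u x) ->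
  pnorm p (rfun u) = expR (log_pnorm p u).
Proof.
move=> u0.
have -> : pnorm p (rfun u) = mean (fun x => expR (p * ln (u x))) `^ p^-1.
  congr ((_ * _) `^ _); apply: eq_bigr => x _.
  by rewrite normc_rfun gtr0_norm// /powR gt_eqF.
by rewrite /powR gt_eqF// mean_gt0// => x; exact: expR_gt0.
Qed.

(** The speed [c] is chosen so that the moving exponent equals [q] exactly at time [t]; the time
    condition says that c <= 1. Domination by the heat flow of a truncated modulus then handles
    complex [f]. *)
Lemma hypercontractive (p q t : R) f : 1 < p -> p <= q -> 0 <= t ->
  2^-1 * ln ((q - 1) / (p - 1)) <= t -> pnorm q (semigroup t f) <= pnorm p f.
Proof.
move=> p1 pq t0; set L := _ * _ => Lt.
have qp0 : 1 <= (q - 1) / (p - 1) by rewrite ler_pdivlMr ?subr_gt0// mul1r lerD2r.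
have L0 : 0 <= L by rewrite mulr_ge0 ?invr_ge0 ?ln_ge0.
have [c c01 qE] : exists2 c, 0 <= c <= 1 & q = 1 + (p - 1) * expR (2 * c * t).
  (* For t = 0 one has L = 0, and c = 0 / 0 = 0 is the right value. *)
  exists (L / t).
    rewrite divr_ge0//=; move: t0; rewrite le_eqVlt => /predU1P[<-|t0].
      by rewrite invr0 mulr0.
    by rewrite ler_pdivrMr// mul1r.
  have -> : 2 * (L / t) * t = ln ((q - 1) / (p - 1)).
    rewrite -mulrA; have [tz|tz] := eqVneq t 0.
      have : L = 0 by apply/eqP; rewrite eq_le L0 -{1}tz Lt.
      by rewrite /L tz mulr0 mulr0 => /eqP; rewrite mulf_eq0 invr_eq0 pnatr_eq0/= => /eqP.
    by rewrite divfK// /L mulVKf.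
  by rewrite lnK ?posrE ?(lt_le_trans _ qp0)//; field; rewrite subr_eq0 gt_eqF.
have p0 : 0 < p by lra.
have q0 : 0 < q by lra.
have bound e : 0 < e ->
    pnorm q (semigroup t f) `^ p <= mean (fun x => normc (f x) `^ p) + e.
  move=> e0; have d0 : 0 < e `^ p^-1 by exact: powR_gt0.
  (* Truncating |f| from below keeps v ^ p below |f| ^ p + e. *)
  pose v x := Num.max (normc (f x)) (e `^ p^-1).
  have v0 x : 0 < v x by rewrite lt_max d0 orbT.
  have vp : mean (fun x => normc (rfun v x) `^ p) <=
      mean (fun x => normc (f x) `^ p) + e.
    rewrite -[X in _ <= _ + X](@mean_cst R n') -meanD; apply: le_mean => x.
    rewrite normc_rfun gtr0_norm//= /v; have [_|_] := leP (normc (f x)) (e `^ p^-1).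
      by rewrite -powRrM mulVf ?gt_eqF// powRr1 ?(ltW e0)// lerDr powR_ge0.
    by rewrite lerDl (ltW e0).
  have pn0 : p != 0 by rewrite gt_eqF.
  apply: le_trans vp; rewrite -[leRHS](pnorm_powR (rfun v) pn0).
  apply: le_powR; [exact: ltW|exact: powR_ge0|].
  apply: (@le_trans _ _ (pnorm q (rfun (convol (heat t) v)))).
    apply: le_pnorm => // x; rewrite normc_rfun.
    apply: le_trans (ler_norm _); apply: normc_semigroup_le => // y.
    by rewrite le_max lexx.
  rewrite (pnorm_rfun q (fun x => convol_heat_gt0 x t0 v0)) (pnorm_rfun p v0).
  by rewrite ler_expR {1}qE; exact: log_pnorm_heat_le.
apply: powR_le_root => //; first exact: powR_ge0.
by apply/ler_addgt0Pr => e; exact: bound.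
Qed.

(** * Necessity of the time condition *)

Lemma fourier_multiplier_chr m k x :
  fourier_multiplier m (chr R k) x = (m k)%:C * chr R k x.
Proof.
have coef (j : 'Z_n) : fourier_coef (chr R k) j = (j == k)%:R.
  rewrite /fourier_coef (@expi_orthogonal R n isT k j (ltZ k) (ltZ j)).
  rewrite natrM mulKf ?pnatr_eq0//.
  by rewrite eq_sym.
rewrite /fourier_multiplier (bigD1 (k : 'I_n))//= [X in _ + X]big1 ?addr0.
  by rewrite coef eqxx mulr1.
by move=> j jk; rewrite coef (negPf jk) mulr0 mul0r.
Qed.

Lemma convol_Re_chr m k x : even_symbol n' m ->
  convol m (fun y => complex.Re (chr R k y)) x = m k * complex.Re (chr R k x).
Proof.
move=> em; have := fourier_multiplier_chr m k x.
rewrite multiplierE// => /(congr1 (@complex.Re R)).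
have ReM (r : R) z : complex.Re (r%:C * z) = r * complex.Re z.
  by case: z => a b /=; rewrite mul0r subr0.
by rewrite raddf_sum ReM => <-; apply: eq_bigr => y _; exact: esym (ReM _ _).
Qed.

Lemma convolD m u v x : convol m (fun y => u y + v y) x = convol m u x + convol m v x.
Proof. by rewrite /convol -big_split; apply: eq_bigr => y _; rewrite mulrDr. Qed.

Lemma convolZ m a u x : convol m (fun y => a * u y) x = a * convol m u x.
Proof. by rewrite /convol mulr_sumr; apply: eq_bigr => y _; rewrite mulrCA. Qed.

Lemma is_derive_log_pnorm (p s : R) (d : 'Z_n -> R) :
  0 < p -> (forall x, 0 < 1 + s * d x) ->
  is_derive s 1 (fun r => log_pnorm p (fun x => 1 + r * d x))
   ((mean (fun x => expR (p * ln (1 + s * d x))))^-1 *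
     mean (fun x => expR ((p - 1) * ln (1 + s * d x)) * d x)).
Proof.
move=> p0 u0.
have du x : is_derive s 1 (fun r => 1 + r * d x) (d x).
  have h := is_derive1_add (is_derive1_cst s 1)
    (is_derive1_mul (is_derive1_id s) (is_derive1_cst s (d x))).
  by apply: (is_derive_eq h); ring.
have n0 : 0 < n%:R^-1 :> R by rewrite invr_gt0 ltr0n.
have pn0 : p != 0 by rewrite gt_eqF.
have h := is_derive_log_sum (w := fun=> p) n0 pn0 u0 (is_derive1_cst s p) du.
apply: (is_derive_eq h); rewrite mul0r add0r.
set Z := n%:R^-1 * _; rewrite -[mean _]/Z.
have -> : mean (fun x => expR ((p - 1) * ln (1 + s * d x)) * d x) =
   n%:R^-1 * \sum_i expR (p * ln (1 + s * d i)) / (1 + s * d i) * d i.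
  congr (_ * _); apply: eq_bigr => x _; congr (_ * _).
  by rewrite mulrBl mul1r expRD expRN lnK ?posrE.
by rewrite mulrACA mulVf ?mul1r// expf_neq0.
Qed.

(** At 0 the second factor is [mean d] = 0 and the first is 1, so only the derivative of the second
    factor contributes. This is the second derivative of the log-norm of 1 + s d at s = 0. *)
Lemma is_derive_log_pnorm2 (p : R) (d : 'Z_n -> R) : mean d = 0 ->
  is_derive (0 : R) 1 (fun s => (mean (fun x => expR (p * ln (1 + s * d x))))^-1 *
     mean (fun x => expR ((p - 1) * ln (1 + s * d x)) * d x))
    ((p - 1) * mean (fun x => d x ^+ 2)).
Proof.
move=> d0.
have du x : is_derive (0 : R) 1 (fun r => 1 + r * d x) (d x).
  have h := is_derive1_add (is_derive1_cst 0 1)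
    (is_derive1_mul (is_derive1_id 0) (is_derive1_cst 0 (d x))).
  by apply: (is_derive_eq h); ring.
have u1 x : 1 + 0 * d x = 1 by rewrite mul0r addr0.
have de (a : R) x : is_derive (0 : R) 1 (fun r => expR (a * ln (1 + r * d x))) (a * d x).
  have u0 : 0 < 1 + 0 * d x by rewrite u1.
  have h := is_derive1_expR (is_derive1_scale a
    (@is_derive1_log R (fun r => 1 + r * d x) 0 (d x) u0 (du x))).
  by apply: (is_derive_eq h); rewrite u1 ln1 mulr0 expR0 invr1 !mul1r.
have Z1 : mean (fun x => expR (p * ln (1 + 0 * d x))) = 1.
  by under eq_fun do rewrite u1 ln1 mulr0 expR0; exact: mean_cst.
have N0 : mean (fun x => expR ((p - 1) * ln (1 + 0 * d x)) * d x) = 0.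
  by under eq_fun do rewrite u1 ln1 mulr0 expR0 mul1r.
have Zn0 : mean (fun x => expR (p * ln (1 + 0 * d x))) != 0 by rewrite Z1 oner_neq0.
have dZ := is_derive1_scale n%:R^-1 (is_derive1_sum (de p)).
have dN := is_derive1_scale n%:R^-1 (is_derive1_sum (fun x =>
  is_derive1_mul (de (p - 1) x) (is_derive1_cst 0 (d x)))).
have h := is_derive1_mul (is_derive1_inv
  (f := fun s => mean (fun x => expR (p * ln (1 + s * d x)))) Zn0 dZ) dN.
apply: (is_derive_eq h).
rewrite -[X in _ + X * _ = _]/(mean (fun x => expR ((p - 1) * ln (1 + 0 * d x)) * d x)).
rewrite N0 Z1 mul0r addr0 invr1 mul1r -meanZ /mean; congr (_ * _).
by apply: eq_bigr => x _; rewrite mulr0 add0r; ring.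
Qed.

Lemma hypercontractive_time_le (p q t : R) : 1 < p -> p <= q -> 0 <= t ->
  (forall f, pnorm q (semigroup t f) <= pnorm p f) ->
  2^-1 * ln ((q - 1) / (p - 1)) <= t.
Proof.
move=> p1 pq t0 hyp.
pose g x := complex.Re (chr R 1 x); pose r := expR (- t).
have r0 : 0 < r by exact: expR_gt0.
have r1 : r <= 1 by rewrite -[leRHS]expR0 ler_expR; lra.
have g1 x : `|g x| <= 1 by rewrite ler_norml cos_geN1 cos_le1.
have mg : mean g = 0 by rewrite /mean sum_Re_chr mulr0.
have mg2 : 0 < mean (fun x => g x ^+ 2).
  rewrite /mean mulr_gt0// big_ord_recl ltr_pwDl// ?sumr_ge0// => [|x _]; last exact: sqr_ge0.
  by rewrite /g chr0 expr1n.
have pos (s a : R) x : 0 <= s < 1 -> 0 < a <= 1 -> 0 < 1 + s * (a * g x).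
  move=> /andP[s0 s1] /andP[a0 a1]; have := g1 x; rewrite ler_norml => /andP[gN1 _].
  have : s * a < 1 by nra.
  have : 0 <= s * a by rewrite mulr_ge0// ltW.
  rewrite mulrA; nra.
have r01 : 0 < r <= 1 by rewrite r0.
(* [g] is an eigenfunction of eigenvalue r = exp(-t), as frequency 1 has word length 1. Thus [F]
   compares the log-norms before and after the semigroup, and contractivity makes it nonnegative. *)
pose F s := log_pnorm p (fun x => 1 + s * (1 * g x)) +
  - 1 * log_pnorm q (fun x => 1 + s * (r * g x)).
pose H (p a s : R) := (mean (fun x => expR (p * ln (1 + s * (a * g x)))))^-1 *
     mean (fun x => expR ((p - 1) * ln (1 + s * (a * g x))) * (a * g x)).
have ma a : mean (fun x => a * g x) = 0 by rewrite meanZ mg mulr0.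
have ma2 a : mean (fun x => (a * g x) ^+ 2) = a ^+ 2 * mean (fun x => g x ^+ 2).
  by rewrite -meanZ; congr mean; apply/funext => x; rewrite exprMn.
have key : 0 <= (p - 1) * mean (fun x => (1 * g x) ^+ 2) +
    - 1 * ((q - 1) * mean (fun x => (r * g x) ^+ 2)).
  (* The radius 1 keeps both test functions positive, since [g] is bounded by 1 and r <= 1. [F] and
     its derivative vanish at 0. *)
  apply: (@second_derivative_test R F (fun s => H p 1 s + - 1 * H q r s) _ 1) => //.
  - move=> s s01; apply: is_derive1_add; last apply: is_derive1_scale.
      by apply: is_derive_log_pnorm; [lra|move=> x; apply: pos; rewrite ?lexx ?ltr01].
    by apply: is_derive_log_pnorm; [lra|move=> x; apply: pos].
  - have H0 a b : H a b 0 = 0.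
      rewrite /H; under [X in _ * mean X]eq_fun
        do rewrite mul0r addr0 ln1 mulr0 expR0 mul1r.
      by rewrite ma mulr0.
    by rewrite !H0 mulr0 addr0.
  - by apply: is_derive1_add; last apply: is_derive1_scale; exact: is_derive_log_pnorm2.
  - move=> s /andP[s0 s1].
    have F0 a b : log_pnorm a (fun x => 1 + 0 * (b * g x)) = 0.
      rewrite /log_pnorm; under eq_fun do rewrite mul0r addr0 ln1 mulr0 expR0.
      by rewrite (mean_cst n' 1) ln1 mulr0.
    rewrite /F !F0 mulr0 addr0 mulN1r subr_ge0 -ler_expR.
    have s01 : 0 <= s < 1 by rewrite s1 ltW.
    have p1s x : 0 < 1 + s * (1 * g x) by apply: pos; rewrite ?lexx ?ltr01.
    have prs x : 0 < 1 + s * (r * g x) by apply: pos.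
    rewrite -(pnorm_rfun p p1s) -(pnorm_rfun q prs).
    suff <- : semigroup t (rfun (fun x => 1 + s * (1 * g x))) =
        rfun (fun x => 1 + s * (r * g x)).
      exact: hyp.
    rewrite semigroupE multiplier_rfun; last exact: even_heat.
    congr rfun.
    apply/funext => x; rewrite convolD convolZ.
    have -> : convol (heat t) (fun=> 1) x = 1.
      have := @convol_Re_chr (heat t) 0 x (@even_heat R n' t).
      rewrite [X in convol _ X](_ : _ = fun=> 1); last first.
        by apply/funext => y; rewrite chrC chr0.
      by move=> ->; rewrite chrC chr0 mulr1 /heat /wlen /word_length min0n mulr0 expR0.
    congr (_ + _ * _).
    under eq_fun do rewrite mul1r.
    rewrite convol_Re_chr; last exact: even_heat.
    by congr (_ * _); rewrite /heat /wlen /word_length/= mulr1.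
move: key; rewrite !ma2 expr1n mul1r mulN1r mulrA -mulrBl pmulr_lge0// subr_ge0 => key.
have q10 : 0 < q - 1 by lra.
have p10 : 0 < p - 1 by lra.
have : ln ((q - 1) / (p - 1)) <= ln (expR (2 * t)).
  rewrite ler_ln ?posrE ?divr_gt0 ?expR_gt0// ler_pdivrMr//.
  have -> : expR (2 * t) = (r ^+ 2)^-1 by rewrite -expRM_natl -expRN; congr expR; ring.
  by rewrite mulrC ler_pdivlMr ?exprn_gt0.
by rewrite expRK; lra.
Qed.

End Hypercontractivity.

Theorem corollary2 (R : realType) (n : nat) (n_ge4 : (4 <= n)%N)
    (p q t : R) (p_gt1 : 1 < p) (p_le_q : p <= q) (t_ge0 : 0 <= t) :
  (forall f : 'Z_n -> R[i], pnorm q (semigroup t f) <= pnorm p f) <->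
  2^-1 * ln ((q - 1) / (p - 1)) <= t.
Proof.
case: n n_ge4 => [|[|[|[|n']]]] n_ge4; [by []|by []|by []|by []|split].
  exact: hypercontractive_time_le.
by move=> t_large f; exact: hypercontractive.
Qed.
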